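(* Let $V$ be a vector space. Then $C_{\mathsf{PL}}^*(V,V)=\bigoplus_{n\ge 0}C_{\mathsf{PL}}^n(V,V)$ with the bracket $$[f,g]_{\mathsf{PL}}:=f\circ g-(-1)^{nm}g\circ f,\qquad f\in C_{\mathsf{PL}}^{n}(V,V),\ g\in C_{\mathsf{PL}}^{m}(V,V),$$ is a graded Lie algebra. Moreover, its Maurer-Cartan elements, i.e. the elements $\pi=(\pi_0,\pi_1)\in C_{\mathsf{PL}}^1(V,V)$ with $[\pi,\pi]_{\mathsf{PL}}=0$, are precisely the post-Lie algebra structures on $V$ (where $\pi_0\in\mathrm{Hom}(\wedge^2V,V)$ is the Lie bracket and $\pi_1\in\mathrm{Hom}(V\otimes V,V)$ is the product $\rhd$).
   Context: The ground field $\mathbf k$ has characteristic zero. A post-Lie algebra $(\mathfrak g,[\cdot,\cdot]_{\mathfrak g},\rhd)$ is a Lie algebra $(\mathfrak g,[\cdot,\cdot]_{\mathfrak g})$ with a bilinear product $\rhd:\mathfrak g\otimes\mathfrak g\to\mathfrak g$ such that $x\rhd[y,z]_{\mathfrak g}=[x\rhd y,z]_{\mathfrak g}+[y,x\rhd z]_{\mathfrak g}$ and $([x,y]_{\mathfrak g}+x\rhd y-y\rhd x)\rhd z=x\rhd(y\rhd z)-y\rhd(x\rhd z)$ for all $x,y,z\in\mathfrak g$. For a vector space $V$ put $C_{\mathsf{PL}}^{n}(V,V)=\bigoplus_{i=0}^{n}\mathrm{Hom}(\wedge^{i}V\otimes \wedge^{n+1-i}V,V)$, $n\ge 0$, and write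 $f=(f_0,\dots,f_n)$ with $f_i\in \mathrm{Hom}(\wedge^iV\otimes\wedge^{n+1-i}V,V)$. Products in exterior powers are written by juxtaposition. $\mathbb S_{(i_1,\dots,i_k)}$ denotes the set of $(i_1,\dots,i_k)$-shuffles (empty if some $i_r<0$) and $(-1)^\sigma$ the sign of $\sigma$. For $f\in C_{\mathsf{PL}}^{n}(V,V)$, $g\in C_{\mathsf{PL}}^{m}(V,V)$, the element $f\circ g=((f\circ g)_0,\dots,(f\circ g)_{n+m})\in C^{n+m}_{\mathsf{PL}}(V,V)$ is defined as follows. For $0\le k\le m$, $$\begin{aligned}&(f\circ g)_k(x_1 \cdots x_{k}\otimes x_{k+1} \cdots x_{n+m+1})=\sum_{0\le j\le k}\ \sum_{\sigma\in\mathbb S_{(k-j,j)}}\ \sum_{\tau\in\mathbb S_{(m+1-j,n+j-k)}}(-1)^\sigma(-1)^\tau(-1)^{m(k-j)}\\ &f_{k-j}\big(x_{\sigma(1)} \cdots x_{\sigma(k-j)}\otimes g_{j}(x_{\sigma(k-j+1)} \cdots x_{\sigma(k)}\otimes x_{k+\tau(1)} \cdots x_{k+\tau(m+1-j)})\, x_{k+\tau(m+2-j)} \cdots x_{k+\tau(n+m+1-k)}\big),\end{aligned}$$ and for $m+1\le k\le m+n$, $$\begin{aligned}&(f\circ g)_{k}(x_1 \cdots x_k\otimes x_{k+1} \cdots x_{n+m+1})\\ =&\sum_{0\le j\le m}\ \sum_{\sigma\in \mathbb S_{(j,m+1-j,k-m-1)}}(-1)^{\sigma}f_{k-m}\big(g_{j}(x_{\sigma(1)}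 \cdots x_{\sigma(j)}\otimes x_{\sigma(j+1)} \cdots x_{\sigma(m+1)})\, x_{\sigma(m+2)} \cdots x_{\sigma(k)}\otimes x_{k+1} \cdots x_{n+m+1}\big)\\ &+\sum_{0\le j\le m}\ \sum_{\sigma\in\mathbb S_{(k-j,j)}}\ \sum_{\tau\in\mathbb S_{(m+1-j,n+j-k)}}(-1)^\sigma(-1)^\tau(-1)^{m(k-j)}\\ &f_{k-j}\big(x_{\sigma(1)} \cdots x_{\sigma(k-j)}\otimes g_{j}(x_{\sigma(k-j+1)} \cdots x_{\sigma(k)}\otimes x_{k+\tau(1)} \cdots x_{k+\tau(m+1-j)})\, x_{k+\tau(m+2-j)} \cdots x_{k+\tau(n+m+1-k)}\big).\end{aligned}$$ *)

(* Defs.v *)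
From HB Require Import structures.
From mathcomp Require Import all_boot all_order all_fingroup all_algebra.
From mathcomp Require Import boolp functions.

Set Implicit Arguments.
Unset Strict Implicit.
Unset Printing Implicit Defensive.

Import GRing.Theory.
Local Open Scope ring_scope.

(** * Graded Lie algebras *)

Section GradedLie.
Variable K : fieldType.

(* A graded vector space [\bigoplus_(n >= 0) L n] is given by its family of
   homogeneous components, and a bilinear bracket of degree 0 on it by its
   restrictions [L n * L m -> L (n + m)].  [degcast] transports an element
   along an equality of degrees. *)
Definition degcast (L : nat -> lmodType K) (n p : nat) (e : n = p) (x : L n) :
  L p := ecast i (L i) e x.

Record graded_Lie_algebra (L : nat -> lmodType K)
    (br : forall n m, L n -> L m -> L (n + m)%N) : Prop := {
  gLie_linearl : forall n m (y : L m), linear (fun x : L n => br n m x y);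
  gLie_linearr : forall n m (x : L n), linear (br n m x);
  gLie_antisym : forall n m (x : L n) (y : L m),
    br n m x y = - ((-1) ^+ (n * m)%N *: degcast (addnC m n) (br m n y x));
  gLie_Jacobi : forall n m p (x : L n) (y : L m) (z : L p),
    br n (m + p)%N x (br m p y z) =
      degcast (esym (addnA n m p)) (br (n + m)%N p (br n m x y) z)
      + (-1) ^+ (n * m)%N *:
          degcast (addnCA m n p) (br m (n + p)%N y (br n p x z)) }.

Definition Maurer_Cartan (L : nat -> lmodType K)
    (br : forall n m, L n -> L m -> L (n + m)%N) (x : L 1) : Prop :=
  br 1 1 x x = 0.

End GradedLie.

(** * Lie and post-Lie algebras *)

Section PostLie.
Variables (K : fieldType) (V : lmodType K).

Record bilinear_op (op : V -> V -> V) : Prop := {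
  bilinear_opl : forall y, linear (fun x => op x y);
  bilinear_opr : forall x, linear (op x) }.

Record Lie_bracket (br : V -> V -> V) : Prop := {
  Lie_bilinear : bilinear_op br;
  Lie_alternating : forall x, br x x = 0;
  Lie_Jacobi : forall x y z,
    br x (br y z) + br y (br z x) + br z (br x y) = 0 }.

Record post_Lie_structure (br rhd : V -> V -> V) : Prop := {
  postLie_Lie : Lie_bracket br;
  postLie_bilinear : bilinear_op rhd;
  postLie_derivation : forall x y z,
    rhd x (br y z) = br (rhd x y) z + br y (rhd x z);
  postLie_curvature : forall x y z,
    rhd (br x y + rhd x y - rhd y x) z = rhd x (rhd y z) - rhd y (rhd x z) }.

End PostLie.

(** * The spaces [Hom (/\^p V (x) /\^q V, V)] *)

Section AltHom.
Variables (K : fieldType) (V : lmodType K).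

Definition subst_tuple p (x : p.-tuple V) (i : 'I_p) (u : V) : p.-tuple V :=
  [tuple if j == i then u else tnth x j | j < p].

Record alternating_map p (W : lmodType K) (F : p.-tuple V -> W) : Prop := {
  alt_multilinear : forall x (i : 'I_p),
    linear (fun u : V => F (subst_tuple x i u));
  alt_repeat : forall x (i j : 'I_p), i != j -> tnth x i = tnth x j ->
    F x = 0 }.

(* By the universal properties of the exterior powers and of the tensor
   product, a linear map [/\^p V (x) /\^q V -> V] is a map
   [(x_1 .. x_p, y_1 .. y_q) |-> f (x_1 .. x_p (x) y_1 .. y_q)]
   alternating multilinear in each of the two groups of variables.  For
   [p = 0] this is no condition on the first group, as [/\^0 V] is the ground
   field. *)
Definition althom_pred p q : {pred (p.-tuple V -> q.-tuple V -> V)} :=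
  fun f => `[< (forall y, alternating_map (fun x => f x y)) /\
               (forall x, alternating_map (f x)) >].
Arguments althom_pred : clear implicits.

Fact althom_submod p q : submod_closed (althom_pred p q).
Proof.
split=> [|a f g /asboolP[fl fr] /asboolP[gl gr]]; apply/asboolP.
  have E x y : (0 : p.-tuple V -> q.-tuple V -> V) x y = 0 by [].
  split=> z; split=> *; rewrite ?E // => c u v; rewrite !E.
    by rewrite scaler0 addr0.
  by rewrite scaler0 addr0.
have E x y : (a *: f + g) x y = a *: f x y + g x y by [].
have D (c : K) (u u' v v' : V) :
    a *: (c *: u + v) + (c *: u' + v') = c *: (a *: u + u') + (a *: v + v').
  by rewrite !scalerDr !scalerA [a * c]mulrC addrACA.
split=> z; split.
- by move=> x i c u v; rewrite !E (alt_multilinear (fl z)) (alt_multilinear (gl z)).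
- move=> x i j ij e; rewrite E (alt_repeat (fl z) ij e).
  by rewrite (alt_repeat (gl z) ij e) scaler0 addr0.
- by move=> x i c u v; rewrite !E (alt_multilinear (fr z)) (alt_multilinear (gr z)).
- move=> x i j ij e; rewrite E (alt_repeat (fr z) ij e).
  by rewrite (alt_repeat (gr z) ij e) scaler0 addr0.
Qed.

HB.instance Definition _ p q :=
  GRing.isSubmodClosed.Build K (p.-tuple V -> q.-tuple V -> V)
    (althom_pred p q) (althom_submod p q).

Record althom p q := AltHom {
  althom_fun :> p.-tuple V -> q.-tuple V -> V;
  althomP : althom_fun \in althom_pred p q }.

HB.instance Definition _ p q := [isSub for @althom_fun p q].
HB.instance Definition _ p q := [Choice of althom p q by <:].
HB.instance Definition _ p q :=
  [SubChoice_isSubLmodule of althom p q by <:].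

End AltHom.

(** * The graded vector space [C_PL^*(V, V)] *)

Section PLcochain.
Variables (K : fieldType) (V : lmodType K) (n : nat).

Definition PLcochain : Type :=
  {dffun forall i : 'I_n.+1, althom V i (n.+1 - i)%N}.

HB.instance Definition _ := Choice.on PLcochain.

Implicit Types f g h : PLcochain.

Let zeroC : PLcochain := [ffun i => 0].
Let oppC f : PLcochain := [ffun i => - f i].
Let addC f g : PLcochain := [ffun i => f i + g i].
Let scaleC (a : K) f : PLcochain := [ffun i => a *: f i].

Fact PLcochain_addA : associative addC.
Proof. by move=> f g h; apply/ffunP=> i; rewrite !ffunE addrA. Qed.
Fact PLcochain_addC : commutative addC.
Proof. by move=> f g; apply/ffunP=> i; rewrite !ffunE addrC. Qed.
Fact PLcochain_add0 : left_id zeroC addC.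
Proof. by move=> f; apply/ffunP=> i; rewrite !ffunE add0r. Qed.
Fact PLcochain_addN : left_inverse zeroC oppC addC.
Proof. by move=> f; apply/ffunP=> i; rewrite !ffunE addNr. Qed.

HB.instance Definition _ := GRing.isZmodule.Build PLcochain
  PLcochain_addA PLcochain_addC PLcochain_add0 PLcochain_addN.

Fact PLcochain_scaleA a b f : scaleC a (scaleC b f) = scaleC (a * b) f.
Proof. by apply/ffunP=> i; rewrite !ffunE scalerA. Qed.
Fact PLcochain_scale1 : left_id 1 scaleC.
Proof. by move=> f; apply/ffunP=> i; rewrite !ffunE scale1r. Qed.
Fact PLcochain_scaleDr : right_distributive scaleC +%R.
Proof. by move=> a f g; apply/ffunP=> i; rewrite !ffunE scalerDr. Qed.
Fact PLcochain_scaleDl f : {morph scaleC^~ f : a b / a + b}.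
Proof. by move=> a b; apply/ffunP=> i; rewrite !ffunE scalerDl. Qed.

HB.instance Definition _ := GRing.Zmodule_isLmodule.Build K PLcochain
  PLcochain_scaleA PLcochain_scale1 PLcochain_scaleDr PLcochain_scaleDl.

(* [PLval f i xs ys] is [f_i (xs (x) ys)]; it is only meaningful for [i <= n]
   and words [xs], [ys] of lengths [i] and [n + 1 - i]. *)
Definition PLval f (i : nat) (xs ys : seq V) : V :=
  if (insub i : option 'I_n.+1) is Some o then
    match (insub xs : option (o.-tuple V)),
          (insub ys : option ((n.+1 - o)%N.-tuple V)) with
    | Some x, Some y => f o x y
    | _, _ => 0
    end
  else 0.

End PLcochain.

(** * The composition [f \o g] and the bracket *)

(* The shuffles of [0 .. N - 1] with blocks of lengths [ns].  When one of the
   lengths is a truncated difference standing for a negative number, the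
   lengths do not add up to [N], and there are no shuffles. *)
Definition shuffles (N : nat) (ns : seq nat) : {set 'S_N} :=
  [set s : 'S_N | (sumn ns == N) &&
     all (sorted ltn) (reshape ns [seq nat_of_ord (s i) | i <- enum 'I_N])].

Section Composition.
Variables (K : fieldType) (V : lmodType K).

Definition permute N (s : 'S_N) (xs : seq V) : seq V :=
  [seq nth 0 xs (s i) | i <- enum 'I_N].

Section Formula.
Variables (n m : nat) (f : PLcochain V n) (g : PLcochain V m).
Variables (k : nat) (xs ys : seq V).

(* [g] inserted in the first group of arguments of [f] *)
Definition PLcirc_left (j : nat) : V :=
  \sum_(s in shuffles k [:: j; m.+1 - j; k - m.+1]%N)
    (let xs' := permute s xs in
     (-1) ^+ s *:
       PLval f (k - m)%N
         (PLval g j (take j xs') (take (m.+1 - j)%N (drop j xs'))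
            :: drop m.+1 xs')
         ys).

(* [g] inserted in the second group of arguments of [f] *)
Definition PLcirc_right (j : nat) : V :=
  \sum_(s in shuffles k [:: k - j; j]%N)
  \sum_(t in shuffles ((n + m).+1 - k)%N [:: m.+1 - j; n + j - k]%N)
    (let xs' := permute s xs in let ys' := permute t ys in
     ((-1) ^+ s * (-1) ^+ t * (-1) ^+ (m * (k - j))%N) *:
       PLval f (k - j)%N
         (take (k - j)%N xs')
         (PLval g j (drop (k - j)%N xs') (take (m.+1 - j)%N ys')
            :: drop (m.+1 - j)%N ys')).

Definition PLcirc_val : V :=
  if (k <= m)%N then \sum_(0 <= j < k.+1) PLcirc_right j
  else \sum_(0 <= j < m.+1) PLcirc_left j + \sum_(0 <= j < m.+1) PLcirc_right j.

End Formula.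

(* [f \o g] is the cochain whose [k]-th component is given by [PLcirc_val];
   that the latter is indeed alternating multilinear in both groups of
   variables is expressed by [PLcirc_well_defined]. *)
Definition PLcirc n m (f : PLcochain V n) (g : PLcochain V m) :
    PLcochain V (n + m)%N :=
  [ffun k : 'I_(n + m)%N.+1 => insubd 0
     (fun (x : k.-tuple V) (y : ((n + m).+1 - k)%N.-tuple V) =>
        PLcirc_val f g k x y)].

Definition PLcirc_well_defined : Prop :=
  forall n m (f : PLcochain V n) (g : PLcochain V m) (k : 'I_(n + m)%N.+1)
    (x : k.-tuple V) (y : ((n + m).+1 - k)%N.-tuple V),
  PLcirc f g k x y = PLcirc_val f g k x y.

Definition PLspace (n : nat) : lmodType K := PLcochain V n.

Definition PLbracket n m (f : PLspace n) (g : PLspace m) : PLspace (n + m)%N :=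
  PLcirc f g
  - (-1) ^+ (n * m)%N *: degcast (L := PLspace) (addnC m n) (PLcirc g f).

Definition PLbr (pi : PLspace 1) (x y : V) : V := PLval pi 0 [::] [:: x; y].
Definition PLrhd (pi : PLspace 1) (x y : V) : V := PLval pi 1 [:: x] [:: y].

End Composition.

Arguments PLcirc_well_defined {K} V.
Arguments PLspace {K} V n.
Arguments PLbracket {K} V n m f g.

(* Main.v *)
(* Two copies of V are used, one for each group of arguments.  A cochain f in
   C_PL^n extends uniquely to an alternating (n+1)-linear map F on V * V which
   maps words containing a letter of the second factor into the second factor,
   by means of the f_i, words in the first factor into the first factor, and
   words in the diagonal into the diagonal.  Maps with these three stability
   properties are closed under the Nijenhuis-Richardson product, and the latter
   restricts to the product f o g: the two kinds of terms in its definition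
   correspond to the factor in which the inner value lies.  The
   Nijenhuis-Richardson product is graded pre-Lie because, by coassociativity
   of the unshuffle coproduct, the associator of F, G, H is a sum over splittings
   of the word into three parts of F(G(c), H(a), d), which is graded symmetric in
   G and H; its commutator therefore satisfies the graded Jacobi identity.  For
   pi in C_PL^1 the three components of pi o pi are the Jacobiator, the
   derivation identity and the curvature identity. *)

Require Import Defs.
From mathcomp Require Import all_boot all_order all_fingroup all_algebra.
From mathcomp Require Import boolp zify.

Set Implicit Arguments.
Unset Strict Implicit.
Unset Printing Implicit Defensive.

Import GRing.Theory.
Local Open Scope ring_scope.

(** * Unshuffle sums *)

Section Unshuffle.
Variable K : fieldType.
Implicit Types U : lmodType K.

(* [dsum s Phi] is the sum of [Phi a b] over the splittings of the word [s]
   into complementary subwords [a] and [b], weighted by the sign of the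
   unshuffle [s -> a ++ b]: the unshuffle coproduct of the exterior algebra,
   taken on words. *)
Fixpoint dsum T U (s : seq T) (Phi : seq T -> seq T -> U) : U :=
  if s is x :: s' then
    dsum s' (fun a b => Phi (x :: a) b)
    + dsum s' (fun a b => (-1) ^+ size a *: Phi a (x :: b))
  else Phi [::] [::].

Lemma eq_dsum T U (s : seq T) (Phi Psi : seq T -> seq T -> U) :
  (forall a b, (size a + size b)%N = size s -> Phi a b = Psi a b) ->
  dsum s Phi = dsum s Psi.
Proof.
elim: s Phi Psi => [|x s IH] Phi Psi E /=; first exact: E.
congr (_ + _); apply: IH => a b sz; rewrite E //= ?addSn ?addnS sz //.
Qed.

Lemma linear_scale U U' (h : U -> U') c u : linear h -> h (c *: u) = c *: h u.
Proof.
move=> lh; have h0 : h 0 = 0.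
  by have /esym/eqP := lh 1 0 0; rewrite !scale1r addr0 -subr_eq0 addrK => /eqP.
by rewrite -[X in h X]addr0 lh h0 addr0.
Qed.

Lemma linear_dsum T U U' (h : U -> U') (s : seq T) Phi : linear h ->
  h (dsum s Phi) = dsum s (fun a b => h (Phi a b)).
Proof.
move=> lh; elim: s Phi => [//|x s IH] Phi /=.
have hD u v : h (u + v) = h u + h v by rewrite -[u]scale1r lh !scale1r.
rewrite hD !IH; congr (_ + _); apply: eq_dsum => a b _.
exact: linear_scale.
Qed.

Lemma dsumD T U (s : seq T) (Phi Psi : seq T -> seq T -> U) :
  dsum s (fun a b => Phi a b + Psi a b) = dsum s Phi + dsum s Psi.
Proof.
elim: s Phi Psi => [//|x s IH] Phi Psi /=.
rewrite IH addrACA; congr (_ + _); rewrite -IH.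
by apply: eq_dsum => a b _; rewrite scalerDr.
Qed.

Lemma dsumZ T U (s : seq T) (c : K) (Phi : seq T -> seq T -> U) :
  dsum s (fun a b => c *: Phi a b) = c *: dsum s Phi.
Proof.
rewrite (@linear_dsum _ _ _ ( *:%R c)) //; exact: linearP.
Qed.

Lemma dsum0 T U (s : seq T) (Phi : seq T -> seq T -> U) :
  (forall a b, (size a + size b)%N = size s -> Phi a b = 0) -> dsum s Phi = 0.
Proof.
by move=> E; rewrite (eq_dsum (Psi := fun _ _ => 0 *: 0)) ?dsumZ ?scale0r //.
Qed.

Lemma dsum_sum T U (I : Type) (r : seq I) (s : seq T) (Phi : I -> seq T -> seq T -> U) :
  dsum s (fun a b => \sum_(i <- r) Phi i a b) = \sum_(i <- r) dsum s (Phi i).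
Proof.
elim: r => [|i r IH].
  by rewrite big_nil dsum0 // => a b _; rewrite big_nil.
rewrite big_cons -IH -dsumD; apply: eq_dsum => a b _; exact: big_cons.
Qed.

Lemma dsum_map T T' U (h : T -> T') (s : seq T) (Phi : seq T' -> seq T' -> U) :
  dsum (map h s) Phi = dsum s (fun a b => Phi (map h a) (map h b)).
Proof.
elim: s Phi => [//|x s IH] Phi /=; rewrite !IH.
by congr (_ + _); apply: eq_dsum => a b _; rewrite size_map.
Qed.

(** Multiplicativity of the unshuffle coproduct: the sign comes from moving [c] past [b]. *)
Lemma dsum_cat T U (s t : seq T) (Phi : seq T -> seq T -> U) :
  dsum (s ++ t) Phi =
  dsum s (fun a b => dsum t (fun c d =>
    (-1) ^+ (size b * size c) *: Phi (a ++ c) (b ++ d))).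
Proof.
elim: s Phi => [|x s IH] Phi /=.
  by apply: eq_dsum => a b _; rewrite mul0n scale1r.
rewrite !IH; congr (_ + _); apply: eq_dsum => a b _ /=; rewrite -dsumZ.
apply: eq_dsum => c d _; rewrite size_cat !scalerA -!exprD.
by congr (_ ^+ _ *: _); rewrite mulSn addnC -addnA.
Qed.

Lemma eq_signr (a b : nat) : odd a = odd b -> (-1) ^+ a = (-1) ^+ b :> K.
Proof. by move=> E; rewrite -[LHS]signr_odd E signr_odd. Qed.

(** Graded cocommutativity of the coproduct: the sign moves one part past the other. *)
Lemma dsumC T U (s : seq T) (Phi : seq T -> seq T -> U) :
  dsum s Phi = dsum s (fun a b => (-1) ^+ (size a * size b) *: Phi b a).
Proof.
elim: s Phi => [|x s IH] Phi /=; first by rewrite scale1r.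
rewrite addrC; congr (_ + _); rewrite [LHS]IH; apply: eq_dsum => a b _;
  rewrite ?scalerA -?exprD ?mulSn ?mulnS //.
  by rewrite addnC.
by congr (_ *: _); apply: eq_signr; rewrite !oddD; case: odd; case: odd.
Qed.

(** Coassociativity: both sides run over the splittings of [s] into three subwords, and either way
    the total sign counts the inversions among the three parts. *)
Lemma dsumA T U (s : seq T) (Phi : seq T -> seq T -> seq T -> U) :
  dsum s (fun e b => dsum e (fun c d => Phi c d b)) =
  dsum s (fun c e => dsum e (fun d b => Phi c d b)).
Proof.
elim: s Phi => [//|x s IH] Phi /=.
rewrite dsumD !IH -addrA; congr (_ + _).
under [in RHS]eq_dsum => a b _ do rewrite scalerDr.
rewrite dsumD; congr (_ + _); first by apply: eq_dsum => a b _; rewrite dsumZ.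
under [RHS]eq_dsum => a b _ do rewrite -dsumZ.
rewrite -IH; apply: eq_dsum => a b _; rewrite -dsumZ; apply: eq_dsum => c d sz.
by rewrite scalerA -exprD sz.
Qed.

(** Counit axiom: a single splitting has an empty left part, and its sign is 1. *)
Lemma dsum_nil_left T U (s : seq T) (Phi : seq T -> U) :
  dsum s (fun a b => if a is [::] then Phi b else 0) = Phi s.
Proof.
elim: s Phi => [//|x s IH] Phi /=; rewrite dsum0 // add0r -(IH (fun b => Phi (x :: b))).
by apply: eq_dsum => -[|y a] b _; rewrite ?scale1r ?scaler0.
Qed.

End Unshuffle.

(** * Alternating functions on words *)

Section Alternating.
Variable K : fieldType.
Implicit Types U W : lmodType K.

(** Words of all lengths are treated at once. Antisymmetry under adjacent swaps is the form that
    passes through induction on words; vanishing on repeated letters follows from it when 2 is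
    invertible. *)
Record altf W U (F : seq W -> U) : Prop := {
  altf_linear : forall a b, linear (fun u => F (a ++ u :: b));
  altf_swap : forall a u v b, F (a ++ u :: v :: b) = - F (a ++ v :: u :: b) }.

Lemma altf_cons W U (F : seq W -> U) x : altf F -> altf (fun s => F (x :: s)).
Proof.
move=> aF; split=> [a b|a u v b]; first exact: (altf_linear aF (x :: a)).
exact: (altf_swap aF (x :: a)).
Qed.

Lemma altf_linear_comp W U U' (h : U -> U') (F : seq W -> U) :
  linear h -> altf F -> altf (fun s => h (F s)).
Proof.
move=> lh aF; split=> [a b c u v|a u v b]; first by rewrite (altf_linear aF) lh.
by rewrite (altf_swap aF) -scaleN1r (linear_scale _ _ lh) scaleN1r.
Qed.

Lemma altf_size_scale W U (c : nat -> K) (F : seq W -> U) :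
  altf F -> altf (fun s => c (size s) *: F s).
Proof.
move=> aF; split=> [a b d u v|a u v b]; rewrite !size_cat /=.
  by rewrite (altf_linear aF) scalerDr !scalerA mulrC.
by rewrite (altf_swap aF) scalerN.
Qed.

Lemma altf_map W W' U (h : W' -> W) (F : seq W -> U) :
  linear h -> altf F -> altf (fun s => F (map h s)).
Proof.
move=> lh aF; split=> [a b c u v|a u v b]; rewrite !map_cat /=.
  by rewrite lh (altf_linear aF).
exact: altf_swap.
Qed.

Lemma altf_zero W U (F : seq W -> U) a b : altf F -> F (a ++ 0 :: b) = 0.
Proof.
move=> aF; have := altf_linear aF a b 1 0 0; rewrite !scale1r addr0.
by move/(congr1 (+%R^~ (- F (a ++ 0 :: b)))); rewrite addrK subrr.
Qed.

Lemma altf_move W U (F : seq W -> U) u a b : altf F ->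
  F (u :: a ++ b) = (-1) ^+ size a *: F (a ++ u :: b).
Proof.
elim: a F => [|x a IH] F aF /=; first by rewrite scale1r.
rewrite (altf_swap aF [::]) /= (IH _ (altf_cons x aF)).
by rewrite exprS mulN1r scaleNr.
Qed.

(** Adjacent swaps bring the first copy of [u] next to the second one; there [F] equals its own
    opposite. *)
Lemma altf_repeat W U (F : seq W -> U) a u b c : (2%:R : K) != 0 ->
  altf F -> F (a ++ u :: b ++ u :: c) = 0.
Proof.
move=> nz2 aF.
have key F' b' : altf F' -> F' (u :: b' ++ u :: c) = 0.
  elim: b' F' => [|x b' IH] F' aF' /=.
    have /eqP := altf_swap aF' [::] u u c; rewrite -addr_eq0 /= -mulr2n -scaler_nat.
    by rewrite scaler_eq0 (negPf nz2) => /eqP.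
  by rewrite (altf_swap aF' [::]) /= (IH _ (altf_cons x aF')) oppr0.
elim: a F aF => [|x a IH] F aF /=; first exact: key.
exact: (IH (fun s => F (x :: s)) (altf_cons x aF)).
Qed.

(** Letters in front of the varied slot are absorbed into [Phi] by induction. For two leading
    letters, splittings that separate them are exchanged in pairs with opposite signs, and the
    others are handled by [al] and [ar]. *)
Lemma altf_dsum W U (Phi : seq W -> seq W -> U) :
  (forall b, altf (Phi^~ b)) -> (forall a, altf (Phi a)) ->
  altf (fun s => dsum s Phi).
Proof.
move=> al ar; split=> [a b c u v|a u v b].
  elim: a Phi al ar => [|x a IH] Phi al ar /=; last first.
    rewrite !IH //; first by rewrite scalerDr addrACA.
    - by move=> d; apply: (altf_size_scale _ (al _)).
    - move=> d; apply: (altf_size_scale (fun=> _)); exact: altf_cons.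
    - by move=> d; exact: altf_cons (al d).
  rewrite -!dsumD -dsumZ -dsumD; apply: eq_dsum => d e _ /=.
  rewrite (altf_linear (al e) [::]) (altf_linear (ar d) [::]) /=.
  by rewrite !scalerDr !scalerA mulrC addrACA.
elim: a Phi al ar => [|x a IH] Phi al ar /=; last first.
  rewrite !IH ?opprD //.
  - by move=> d; apply: (altf_size_scale _ (al _)).
  - move=> d; apply: (altf_size_scale (fun=> _)); exact: altf_cons.
  - by move=> d; exact: altf_cons (al d).
rewrite -!dsumD -[RHS]scaleN1r -dsumZ; apply: eq_dsum => d e _.
rewrite (altf_swap (al e) [::]) (altf_swap (ar d) [::]) /= !exprS !mulN1r.
by rewrite !scalerDr !scaleN1r !scalerN !scaleNr !opprK addrACA.
Qed.

End Alternating.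

(** * Shuffles as unshuffle sums *)

Section Insertion.

Definition insert_at T i (x : T) (w : seq T) := take i w ++ x :: drop i w.

Lemma nth_insert_at T (x0 x : T) i w : (i <= size w)%N ->
  nth x0 (insert_at i x w) i = x.
Proof.
by move=> le_iw; rewrite nth_cat size_take_min (minn_idPl le_iw) ltnn subnn.
Qed.

Lemma nth_insert_at_bump T (x0 x : T) i w k : (i <= size w)%N ->
  nth x0 (insert_at i x w) (bump i k) = nth x0 w k.
Proof.
move=> le_iw; rewrite nth_cat size_take_min (minn_idPl le_iw) /bump.
case: (leqP i k) => [le_ik|lt_ki]; last by rewrite add0n lt_ki nth_take.
by rewrite add1n ltnNge leqW //= subSn //= nth_drop subnKC.
Qed.

Lemma map_insert_at T T' (h : T -> T') i x w :
  map h (insert_at i x w) = insert_at i (h x) (map h w).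
Proof. by rewrite map_cat /= map_take map_drop. Qed.

Lemma cat_insert_at T (a : seq T) i x w :
  insert_at (size a + i) x (a ++ w) = a ++ insert_at i x w.
Proof.
by rewrite /insert_at take_cat drop_cat ltnNge leq_addr /= addKn -catA.
Qed.

Lemma take_insert_at T n i (x : T) w : (i < n)%N -> (i <= size w)%N ->
  take n (insert_at i x w) = insert_at i x (take n.-1 w).
Proof.
case: n => // n le_in le_iw; rewrite /insert_at take_cat size_take_min.
rewrite (minn_idPl le_iw) ltnNge ltnW //= subSn //= take_drop subnK //.
by rewrite take_takel.
Qed.

(* In a shuffle the smallest letter stands at the head of a block;
   [decr_block ns i] shortens the nonempty block of [ns] starting at position
   [i], and is [None] if there is none. *)
Fixpoint decr_block (ns : seq nat) (i : nat) : option (seq nat) :=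
  if ns is n :: ns' then
    if (i < n)%N then (if i == 0%N then Some (n.-1 :: ns') else None)
    else omap (cons n) (decr_block ns' (i - n))
  else None.

Lemma sumn_decr_block ns i ns' :
  decr_block ns i = Some ns' -> sumn ns = (sumn ns').+1.
Proof.
elim: ns i ns' => [//|n ns IH] i ns' /=.
case: ltnP => [lt_in|_]; first by case: eqP => // _ [<-]; case: n lt_in.
by case E: decr_block => [l|//] [<-] /=; rewrite (IH _ _ E) addnS.
Qed.

Lemma sorted_insert_min w i : (0 < i <= size w)%N ->
  sorted ltn (insert_at i 0 (map S w)) = false.
Proof.
case: i w => [//|i] [//|x w] /= _; apply/negP=> /(order_path_min ltn_trans).
by move/allP/(_ 0); rewrite mem_cat inE eqxx orbT; move=> /(_ isT).
Qed.

Lemma sorted_mapS w : sorted ltn (map S w) = sorted ltn w.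
Proof. by rewrite (sorted_map (e' := ltn)). Qed.

(** All other letters being positive, the inserted [0] leaves the blocks increasing only at the head
    of its block; removing it then shortens that block. *)
Lemma reshape_insert_min ns i w : (i <= size w)%N -> sumn ns = (size w).+1 ->
  all (sorted ltn) (reshape ns (insert_at i 0 (map S w))) =
  if decr_block ns i is Some ns' then all (sorted ltn) (reshape ns' w) else false.
Proof.
have red ns' w' : all (sorted ltn) (reshape ns' (map S w')) =
    all (sorted ltn) (reshape ns' w').
  elim: ns' w' => [//|m ns' IH] w' /=.
  by rewrite -map_take -map_drop sorted_mapS IH.
elim: ns i w => [//|n ns IH] i w le_iw /= sz.
case: ltnP => [lt_in|le_ni].
  rewrite take_insert_at ?size_map // -map_take.
  case: posnP => [i0|i_gt0].
    subst i; case: n lt_in sz => // n _ [sz].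
    rewrite /insert_at take0 !drop0 /= take0 /= -map_drop red -sorted_mapS.
    by case: (take n w).
  rewrite sorted_insert_min // i_gt0 size_take_min leq_min le_iw.
  by rewrite -ltnS (ltn_predK lt_in) lt_in.
have szt : size (take n (map S w)) = n.
  by rewrite size_take_min size_map (minn_idPl (leq_trans le_ni le_iw)).
have -> : insert_at i 0 (map S w) =
    take n (map S w) ++ insert_at (i - n) 0 (map S (drop n w)).
  by rewrite -cat_insert_at szt subnKC // map_drop cat_take_drop.
rewrite take_size_cat // drop_size_cat // -map_take sorted_mapS IH.
- by case: decr_block => [l|] /=; rewrite ?andbF.
- by rewrite size_drop leq_sub2r.
- apply/eqP; rewrite -(eqn_add2l n) sz size_drop -subSn ?subnKC //.
    by rewrite leqW // (leq_trans le_ni).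
  by rewrite (leq_trans le_ni).
Qed.

End Insertion.

(** * Signed sums over shuffles with prescribed block lengths *)

Section ShuffleSum.
Variable K : fieldType.
Implicit Types U : lmodType K.

(** Iterated coproduct, restricted to parts of lengths [ns]. Letters left after the last block are
    appended; there are none when the lengths add up to [size s]. *)
Fixpoint block_sum T U (ns : seq nat) (s : seq T) (Phi : seq T -> U) : U :=
  if ns is n :: ns' then
    dsum s (fun a b => if size a == n then block_sum ns' b (fun w => Phi (a ++ w)) else 0)
  else Phi s.

Lemma eq_block_sum T U ns (s : seq T) (Phi Psi : seq T -> U) :
  Phi =1 Psi -> block_sum ns s Phi = block_sum ns s Psi.
Proof.
elim: ns s Phi Psi => [|n ns IH] s Phi Psi E /=; first exact: E.
by apply: eq_dsum => a b _; case: eqP => // _; apply: IH => w; apply: E.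
Qed.

(** The first letter heads one of the blocks; if it ends at position [i], it has passed [i] letters,
    whence the sign. This is the recursion that shuffles satisfy for the position of [0]. *)
Lemma block_sum_cons T U ns x (s : seq T) (Phi : seq T -> U) :
  sumn ns = (size s).+1 ->
  block_sum ns (x :: s) Phi =
  \sum_(i < (size s).+1) if decr_block ns i is Some ns' then
     (-1) ^+ i *: block_sum ns' s (fun w => Phi (insert_at i x w)) else 0.
Proof.
elim: ns s Phi => [//|n ns IH] s Phi /= sz.
rewrite -(big_mkord xpredT (fun i =>
   if (if (i < n)%N then (if i == 0%N then Some (n.-1 :: ns) else None)
     else omap (cons n) (decr_block ns (i - n))) is Some ns'
   then (-1) ^+ i *: block_sum ns' s (fun w => Phi (insert_at i x w)) else 0)).
have le_n : (n <= (size s).+1)%N by rewrite -sz leq_addr.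
(* Positions below [n] lie in the first block, where only its head can contribute; later positions
   belong to the other blocks and fall under the induction hypothesis. *)
rewrite (big_cat_nat (n := n)) //=; congr (_ + _).
  case: n le_n sz => [|n] le_n sz.
    by rewrite big_geq // dsum0.
  rewrite big_ltn //= big_nat big1 ?addr0 => [|i /andP[i0 ->]]; last first.
    by rewrite gtn_eqF.
  rewrite scale1r; apply: eq_dsum => a b _; rewrite eqSS.
  by case: eqP => // _; apply: eq_block_sum => w; rewrite /insert_at take0 drop0.
rewrite (eq_dsum (Psi := fun a b => \sum_(n <= i < (size s).+1)
   if decr_block ns (i - n) is Some ns' then
     if size a == n then
       (-1) ^+ i *: block_sum ns' b (fun w => Phi (insert_at i x (a ++ w)))
     else 0 else 0)) => [|a b sab].
  rewrite dsum_sum; apply: eq_big_nat => i /andP[le_ni _]; rewrite ltnNge le_ni /=.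
  case: decr_block => [ns'|] /=; last by rewrite dsum0.
  by rewrite -dsumZ; apply: eq_dsum => a b _; case: eqP => //; rewrite scaler0.
case: eqP => [an|_]; last first.
  by rewrite scaler0 big1 // => i _; case: decr_block.
have szb : sumn ns = (size b).+1.
  by apply/eqP; rewrite -(eqn_add2l n) sz -sab an addnS.
rewrite IH // scaler_sumr -[X in index_iota X _]add0n big_addn.
rewrite -sab an -addnS addKn big_mkord.
apply: eq_bigr => i _; rewrite addnK; case: decr_block => [ns'|]; last by rewrite scaler0.
rewrite scalerA -exprD addnC; congr (_ *: _); apply: eq_block_sum => w.
by rewrite -an addnC cat_insert_at.
Qed.

Definition perm_word N (s : 'S_N) : seq nat := [seq nat_of_ord (s i) | i <- enum 'I_N].

Lemma perm_word_lift N (i : 'I_N.+1) (s : 'S_N) :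
  perm_word (lift_perm i ord0 s) = insert_at i 0 (map S (perm_word s)).
Proof.
have szw M (s' : 'S_M) : size (perm_word s') = M by rewrite size_map size_enum_ord.
have le_i : (i <= size (map S (perm_word s)))%N by rewrite size_map szw -ltnS.
have nthw M (s' : 'S_M) (k : 'I_M) : nth 0 (perm_word s') k = s' k.
  by rewrite (nth_map k) ?size_enum_ord // nth_ord_enum.
apply: (@eq_from_nth _ 0).
  by rewrite szw size_cat /= addnS -size_cat cat_take_drop size_map szw.
move=> k; rewrite szw => lt_k; rewrite -[k]/(nat_of_ord (Ordinal lt_k)) nthw.
case: (unliftP i (Ordinal lt_k)) => [j|] ->.
  rewrite lift_perm_lift [in RHS]/= nth_insert_at_bump // (nth_map 0) ?szw // nthw.
  by [].
by rewrite lift_perm_id nth_insert_at.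
Qed.

Lemma permuteE (V : lmodType K) N (s : 'S_N) (xs : seq V) :
  permute s xs = [seq nth 0 xs j | j <- perm_word s].
Proof. by rewrite /permute /perm_word -map_comp. Qed.

Lemma permute_lift (V : lmodType K) N (i : 'I_N.+1) (s : 'S_N) x (xs : seq V) :
  permute (lift_perm i ord0 s) (x :: xs) = insert_at i x (permute s xs).
Proof. by rewrite !permuteE perm_word_lift map_insert_at -map_comp. Qed.

Lemma shuffles_lift N ns (i : 'I_N.+1) (s : 'S_N) : sumn ns = N.+1 ->
  (lift_perm i ord0 s \in shuffles N.+1 ns) =
  if decr_block ns i is Some ns' then s \in shuffles N ns' else false.
Proof.
move=> sz; have szw : size (perm_word s) = N by rewrite size_map size_enum_ord.
rewrite inE sz eqxx [in LHS]/= -/(perm_word _) perm_word_lift.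
rewrite reshape_insert_min ?szw -1?ltnS //.
by case E: decr_block => [ns'|] //; rewrite inE -eqSS -(sumn_decr_block E) sz eqxx.
Qed.

(* A permutation is determined by the position of [0] and by the pattern of the
   remaining letters. *)
Lemma lift_perm_bij N :
  bijective (fun p : 'I_N.+1 * 'S_N => lift_perm p.1 ord0 p.2).
Proof.
apply: inj_card_bij => [[i s] [j t] /= E|]; last first.
  by rewrite card_prod card_ord !card_Sn factS.
have ij : i = j.
  by apply: (@perm_inj _ (lift_perm i ord0 s)); rewrite {2}E !lift_perm_id.
by subst j; congr (_, _); apply/permP => k; apply: (@lift_inj _ ord0);
  rewrite -!(lift_perm_lift i) E.
Qed.

(** Both sides satisfy the same recursion on the first letter: deleting [0] at position [i] from a
    permutation splits off the factor [(-1) ^+ i] of its sign. *)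
Lemma shuffle_sum (V U : lmodType K) N ns (xs : seq V) (Phi : seq V -> U) :
  size xs = N -> sumn ns = N ->
  \sum_(s in shuffles N ns) (-1) ^+ s *: Phi (permute s xs) = block_sum ns xs Phi.
Proof.
elim: N ns xs Phi => [|N IH] ns xs Phi szx szn.
  case: xs szx => // _; rewrite (big_pred1 1%g) => [|s].
    have -> : permute (1%g : 'S_0) ([::] : seq V) = [::].
      by apply: size0nil; rewrite size_map size_enum_ord.
    rewrite odd_perm1 scale1r.
    elim: ns szn Phi => [//|n ns IHn] /= /eqP.
    rewrite addn_eq0 => /andP[/eqP-> /eqP ns0] Phi /=.
    exact: IHn.
  have -> : s = 1%g by apply/permP => -[].
  rewrite inE szn eqxx [RHS]eqxx /=; set w := map _ _.
  have {w} -> : w = [::] by apply: size0nil; rewrite size_map size_enum_ord.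
  by elim: ns {szn} => //.
case: xs szx => [//|x xs] [szx].
rewrite big_mkcond (reindex _ (onW_bij _ (lift_perm_bij N))) /=.
rewrite -(pair_bigA _ (fun i s => if lift_perm i ord0 s \in shuffles N.+1 ns then
  (-1) ^+ lift_perm i ord0 s *: Phi (permute (lift_perm i ord0 s) (x :: xs)) else 0)).
rewrite block_sum_cons ?szx //; apply: eq_bigr => i _.
under eq_bigr => s _ do rewrite shuffles_lift //.
case E: decr_block => [ns'|]; last by rewrite big1.
rewrite -big_mkcond -IH //; last by apply: succn_inj; rewrite -(sumn_decr_block E).
rewrite scaler_sumr; apply: eq_bigr => s _.
by rewrite permute_lift odd_lift_perm /= addbF signr_addb signr_odd scalerA.
Qed.

End ShuffleSum.

(** * Shuffles with two and three blocks *)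

Section Blocks.
Variables (K : fieldType).
Implicit Types U V : lmodType K.

Lemma dsum_full T U (s : seq T) (Phi : seq T -> U) :
  dsum s (fun a b => if size a == size s then Phi (a ++ b) else 0) = Phi s.
Proof.
elim: s Phi => [//|x s IH] Phi /=; rewrite [X in _ + X]dsum0 => [|a b].
  by rewrite addr0 -(IH (fun s => Phi (x :: s))).
by move=> <-; rewrite -addnS -[X in X == _]addn0 eqn_add2l scaler0.
Qed.

Lemma shuffle_sum2 V U N p q (xs : seq V) (Phi : seq V -> seq V -> U) :
  size xs = N -> (p + q)%N = N ->
  \sum_(s in shuffles N [:: p; q])
    (-1) ^+ s *: Phi (take p (permute s xs)) (drop p (permute s xs)) =
  dsum xs (fun a b => if size a == p then Phi a b else 0).
Proof.
move=> szx pq.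
rewrite (shuffle_sum (fun w => Phi (take p w) (drop p w))) //= ?addn0 //.
apply: eq_dsum => a b sab; case: eqP => // szp.
(* The last block consists of all remaining letters, so [dsum_full] collapses its sum to one
   splitting. *)
have -> : q = size b by apply/eqP; rewrite -(eqn_add2l p) pq -szx -sab szp.
rewrite (dsum_full _ (fun w => Phi (take p (a ++ w)) (drop p (a ++ w)))).
by rewrite take_size_cat ?drop_size_cat.
Qed.

(** [block_sum] peels off the first block first, whereas here the first two are grouped into [e],
    the letters to be fed to one cochain; coassociativity relates the two nestings. *)
Lemma shuffle_sum3 V U N p q r (xs : seq V) (Phi : seq V -> seq V -> seq V -> U) :
  size xs = N -> (p + q + r)%N = N ->
  \sum_(s in shuffles N [:: p; q; r])
    (-1) ^+ s *: Phi (take p (permute s xs)) (take q (drop p (permute s xs)))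
                     (drop (p + q) (permute s xs)) =
  dsum xs (fun e c => if size e == (p + q)%N then
    dsum e (fun a b => if size a == p then Phi a b c else 0) else 0).
Proof.
move=> szx pqr.
rewrite (shuffle_sum (fun w => Phi (take p w) (take q (drop p w)) (drop (p + q) w)))
  //= ?addn0 ?addnA //.
pose Psi a b c : U := if (size a == p) && (size b == q) then Phi a b c else 0.
rewrite [RHS](eq_dsum (Psi := fun e c => dsum e (fun a b => Psi a b c))).
  rewrite dsumA; apply: eq_dsum => a e sae; case: eqP => [ap|/eqP/negPf ap].
    apply: eq_dsum => b c sbc; rewrite /Psi ap eqxx /=; case: eqP => // bq.
    have -> : r = size c by lia.
    rewrite (dsum_full _ (fun w => Phi (take p (a ++ b ++ w))
       (take q (drop p (a ++ b ++ w))) (drop (p + q) (a ++ b ++ w)))).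
    rewrite take_size_cat // drop_size_cat // take_size_cat //.
    by rewrite catA drop_size_cat // size_cat ap bq.
  by rewrite dsum0 // => b c _; rewrite /Psi ap.
move=> e c _; case: eqP => [epq|epq].
  apply: eq_dsum => a b; rewrite /Psi epq; case: eqP => //= -> /eqP.
  by rewrite eqn_add2l => ->.
by rewrite dsum0 // => a b sab; rewrite /Psi; case: eqP => //= ap; case: eqP => // bq;
  case: epq; rewrite -sab ap bq.
Qed.

End Blocks.

(** * Passage between alternating maps on tuples and on words *)

Section AlternatingTuples.
Variable K : fieldType.
Implicit Types U V : lmodType K.

Lemma subst_tupleE V p (x : p.-tuple V) (i : 'I_p) u :
  subst_tuple x i u = take i x ++ u :: drop i.+1 x :> seq V.
Proof.
have lt_i : (i < size x)%N by rewrite size_tuple.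
apply: (@eq_from_nth _ 0) => [|k].
  rewrite size_tuple size_cat size_takel ?(ltnW lt_i) //= size_drop.
  by rewrite addnS -addSn subnKC // (size_tuple x).
rewrite size_tuple => lt_k; rewrite -[k]/(nat_of_ord (Ordinal lt_k)) -tnth_nth.
rewrite tnth_mktuple.
rewrite nth_cat size_takel ?(ltnW lt_i) // -val_eqE. simpl val.
case: ltngtP => [lt_ki|lt_ik|->]; last by rewrite subnn.
  by rewrite nth_take // (tnth_nth 0).
by rewrite -[(k - i)%N]prednK ?subn_gt0 //= nth_drop -subnS subnKC // (tnth_nth 0).
Qed.

Lemma altf_alternating V U p (F : seq V -> U) : (2%:R : K) != 0 -> altf F ->
  alternating_map (fun t : p.-tuple V => F t).
Proof.
move=> nz2 aF; split=> [x i c u v|]; first by rewrite !subst_tupleE (altf_linear aF).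
move=> x; suff ltP (i j : 'I_p) : (i < j)%N -> tnth x i = tnth x j -> F x = 0.
  move=> i j; rewrite -val_eqE neq_ltn => /orP[|lt_ji e]; first exact: ltP.
  exact: (ltP j i).
move=> lt_ij e; have szx := size_tuple x.
have lt_i : (i < size x)%N by rewrite szx.
have lt_j : (j < size x)%N by rewrite szx.
rewrite -(cat_take_drop i x) (drop_nth 0) // -tnth_nth.
rewrite -(cat_take_drop (j - i.+1) (drop i.+1 x)) drop_drop subnK //.
by rewrite (drop_nth 0 lt_j) -tnth_nth -e (altf_repeat _ _ _ _ nz2 aF).
Qed.

(** Extension by zero to words of other lengths; antisymmetry is obtained by polarization, from the
    vanishing at [u + v] repeated. *)
Lemma alternating_altf V U p (F : p.-tuple V -> U) : alternating_map F ->
  altf (fun s : seq V => if (insub s : option (p.-tuple V)) is Some t then F t else 0).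
Proof.
move=> aF; set G := fun s => _.
have lG a b : linear (fun u => G (a ++ u :: b)).
  move=> c u v; have [szp|szp] := eqVneq (size a + (size b).+1)%N p; last first.
    by rewrite /G !insubN ?size_cat //= scaler0 addr0.
  have sz w : size (a ++ w :: b) == p by rewrite size_cat szp.
  have lt_a : (size a < p)%N by rewrite -szp addnS ltnS leq_addr.
  have GE w : G (a ++ w :: b) = F (subst_tuple (Tuple (sz 0)) (Ordinal lt_a) w).
    rewrite /G (insubT (fun s : seq V => size s == p) (sz w)); congr F.
    apply: val_inj; rewrite [RHS]subst_tupleE /=.
    by rewrite take_size_cat // -(cat_rcons 0) drop_size_cat ?size_rcons.
  by rewrite !GE (alt_multilinear aF).
split=> // a u v b; have G0 w : G (a ++ w :: w :: b) = 0.
  rewrite /G; case: insubP => [t _ tE|//].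
  have szt : ((size a).+2 <= p)%N.
    by rewrite -(size_tuple t) tE size_cat /= !addnS !ltnS leq_addr.
  apply: (alt_repeat aF (i := Ordinal (ltnW szt)) (j := Ordinal szt)).
    by rewrite -val_eqE /= ltn_eqF.
  rewrite !(tnth_nth 0) tE /= -cat_rcons !nth_cat size_rcons ltnn ltnSn subnn.
  by rewrite nth_rcons ltnn eqxx.
have E w w' x :
    G (a ++ (w + w') :: x :: b) = G (a ++ w :: x :: b) + G (a ++ w' :: x :: b).
  by rewrite -[w]scale1r lG !scale1r.
have E' w w' x :
    G (a ++ x :: (w + w') :: b) = G (a ++ x :: w :: b) + G (a ++ x :: w' :: b).
  by rewrite -!(cat_rcons x) -[w]scale1r lG !scale1r.
by have /eqP := G0 (u + v); rewrite E !E' !G0 add0r addr0 addr_eq0 => /eqP.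
Qed.

End AlternatingTuples.

(** * The Nijenhuis-Richardson product *)

Section NijenhuisRichardson.
Variables (K : fieldType) (W : lmodType K).
Implicit Types F G H : seq W -> W.

(** No length is imposed on [a]: for homogeneous [G], parts of the wrong length contribute zero,
    since then the first argument of [F] vanishes. *)
Definition NRcirc F G (s : seq W) : W := dsum s (fun a b => F (G a :: b)).

Definition homog n F := forall s, size s != n.+1 -> F s = 0.

Lemma altf_cons_linear F b : altf F -> linear (fun u => F (u :: b)).
Proof. by move=> aF; exact: (altf_linear aF [::]). Qed.

Lemma altf_NRcirc F G : altf F -> altf G -> altf (NRcirc F G).
Proof.
move=> aF aG; apply: altf_dsum => [b|a]; last exact: altf_cons.
exact: altf_linear_comp (altf_cons_linear b aF) aG.
Qed.

Lemma homog_NRcirc n m F G : altf F -> homog n F -> homog m G -> homog (n + m) (NRcirc F G).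
Proof.
move=> aF hF hG s szs; apply: dsum0 => a b sab.
have [sa|sa] := eqVneq (size a) m.+1; last by rewrite (hG _ sa) (altf_zero [::] b aF).
by apply: hF; apply: contra szs => /= /eqP[sb]; rewrite -sab sa sb addnC addnS.
Qed.

Lemma NRcircDl F1 F2 G :
  NRcirc (fun s => F1 s + F2 s) G =1 (fun s => NRcirc F1 G s + NRcirc F2 G s).
Proof. by move=> s; rewrite /NRcirc dsumD. Qed.

Lemma NRcircZl c F G : NRcirc (fun s => c *: F s) G =1 (fun s => c *: NRcirc F G s).
Proof. by move=> s; rewrite /NRcirc dsumZ. Qed.

Lemma NRcirc_linearr c F G1 G2 : altf F ->
  NRcirc F (fun s => c *: G1 s + G2 s) =1 (fun s => c *: NRcirc F G1 s + NRcirc F G2 s).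
Proof.
move=> aF s; rewrite /NRcirc -dsumZ -dsumD; apply: eq_dsum => a b _.
exact: altf_cons_linear.
Qed.

Lemma eq_NRcirc F F' G G' : F =1 F' -> G =1 G' -> NRcirc F G =1 NRcirc F' G'.
Proof. by move=> eF eG s; apply: eq_dsum => a b _; rewrite eF eG. Qed.

Definition NRassoc F G H s := NRcirc (NRcirc F G) H s - NRcirc F (NRcirc G H) s.

(* By coassociativity, the terms of [(F o G) o H] in which [G] receives the value
   of [H] make up [F o (G o H)]. *)
Lemma NRassocE F G H s : altf F ->
  NRassoc F G H s = dsum s (fun a e => dsum e (fun c d =>
    (-1) ^+ size c *: F (G c :: H a :: d))).
Proof.
move=> aF; rewrite /NRassoc /NRcirc.
have -> : dsum s (fun a b => F (dsum a (fun c d => G (H c :: d)) :: b)) =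
    dsum s (fun e b => dsum e (fun c d => F (G (H c :: d) :: b))).
  by apply: eq_dsum => a b _; exact: (linear_dsum _ _ (altf_cons_linear b aF)).
rewrite dsumA -scaleN1r -dsumZ -dsumD; apply: eq_dsum => a b _.
by rewrite /= scaleN1r addrAC subrr add0r.
Qed.

(** Exchanging the parts fed to [G] and [H] gives the sign of cocommutativity, and exchanging the
    two values in [F] gives one more. *)
Lemma NRassoc_sym m p F G H s : altf F -> homog m G -> homog p H ->
  NRassoc F G H s = (-1) ^+ (m * p) *: NRassoc F H G s.
Proof.
move=> aF hG hH; rewrite !NRassocE //.
rewrite -(dsumA s (fun a c d => (-1) ^+ size c *: F (G c :: H a :: d))).
rewrite -(dsumA s (fun a c d => (-1) ^+ size c *: F (H c :: G a :: d))).
rewrite -dsumZ; apply: eq_dsum => e d _; rewrite dsumC -dsumZ.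
apply: eq_dsum => a c _; rewrite !scalerA.
(* The parity count needs the exact lengths [m.+1] and [p.+1]; for other lengths [G a] or [H c] is
   zero and both sides vanish. *)
have [sa|sa] := eqVneq (size a) m.+1; last first.
  by rewrite (hG _ sa) (altf_zero [:: _] d aF) (altf_zero [::] _ aF) !scaler0.
have [sc|sc] := eqVneq (size c) p.+1; last first.
  by rewrite (hH _ sc) (altf_zero [:: _] d aF) (altf_zero [::] _ aF) !scaler0.
rewrite (altf_swap aF [::]) /= -scaleN1r scalerA sa sc -!exprD.
rewrite -[X in _ * X]expr1 -exprD; congr (_ *: _).
apply: eq_signr; rewrite !(oddD, oddM, oddS) /=.
by case: (odd m); case: (odd p).
Qed.

End NijenhuisRichardson.

(** * The embedding into the cochains of [V * V] *)

Section Embedding.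
Variables (K : fieldType) (V : lmodType K).
Implicit Types (xs ys : seq V) (s : seq (V * V)%type).

(** The length of [xs] selects the component, so that a cochain becomes one function on pairs of
    words, zero at lengths that do not fit; in particular it vanishes for empty [ys]. *)
Definition fval n (f : PLcochain V n) xs ys : V := PLval f (size xs) xs ys.

Lemma PLval_tuple n (f : PLcochain V n) (i : 'I_n.+1) (x : i.-tuple V)
  (y : (n.+1 - i).-tuple V) : PLval f i x y = f i x y.
Proof. by rewrite /PLval !valK. Qed.

Lemma PLval0 n (f : PLcochain V n) i xs ys :
  ~~ [&& (i <= n)%N, size xs == i & size ys == n.+1 - i]%N -> PLval f i xs ys = 0.
Proof.
rewrite /PLval; case: insubP => [o lt_o oE|//]; rewrite -ltnS lt_o -oE /=.
case: insubP => [x _ <-|//]; case: insubP => [y _ <-|//]; by rewrite !size_tuple !eqxx.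
Qed.

Lemma PLval_fval n (f : PLcochain V n) i xs ys :
  PLval f i xs ys = if size xs == i then fval f xs ys else 0.
Proof.
case: eqP => [<-//|/eqP/negPf szx]; by rewrite PLval0 // szx andbF.
Qed.

Lemma fval0 n (f : PLcochain V n) xs ys :
  ~~ ((size xs <= n) && (size xs + size ys == n.+1))%N -> fval f xs ys = 0.
Proof.
move=> h; apply: PLval0; apply: contra h => /and3P[le_n _ /eqP->]; rewrite le_n /=.
by rewrite subnKC // leqW.
Qed.

Lemma fval_nil n (f : PLcochain V n) xs : fval f xs [::] = 0.
Proof.
by rewrite fval0 // addn0; apply/negP=> /andP[le_n /eqP E]; rewrite E ltnn in le_n.
Qed.

Lemma althom_alternating p q (f : althom V p q) :
  (forall y, alternating_map (fun x => f x y)) /\ (forall x, alternating_map (f x)).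
Proof. exact/asboolP/(althomP f). Qed.

Lemma eq_altf (W U : lmodType K) (F G : seq W -> U) : F =1 G -> altf F -> altf G.
Proof. by move=> E aF; have -> : G = F by apply/funext => s; rewrite E. Qed.

Lemma altf0 (W U : lmodType K) : altf (fun _ : seq W => 0 : U).
Proof. by split=> *; rewrite ?oppr0 // => c u v; rewrite scaler0 addr0. Qed.

Lemma altf_fvalr n (f : PLcochain V n) xs : altf (fval f xs).
Proof.
have [le_n|lt_n] := leqP (size xs) n; last first.
  apply: eq_altf (@altf0 _ _) => ys; rewrite fval0 // leqNgt lt_n //.
have [_ /(_ (in_tuple xs))] :=
  althom_alternating (f (Ordinal (le_n : (size xs < n.+1)%N))).
move/alternating_altf; apply: eq_altf => ys; rewrite /fval /PLval.
rewrite (insubT (fun i => i < n.+1)%N (le_n : (size xs < n.+1)%N)) /=.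
by rewrite (insubT (fun s : seq V => size s == size xs) (eqxx _)).
Qed.

Lemma altf_fvall n (f : PLcochain V n) ys : altf (fval f ^~ ys).
Proof.
(* The component index is frozen first, because in [fval] it depends on the varying word; both
   axioms of [altf] compare words of equal length. *)
suff aP i : altf (fun xs => PLval f i xs ys).
  split=> [a b c u v|a u v b]; rewrite /fval !size_cat /=.
    exact: (altf_linear (aP _)).
  exact: (altf_swap (aP _)).
have [le_n|lt_n] := leqP i n; last first.
  apply: eq_altf (@altf0 _ _) => xs; rewrite PLval0 // leqNgt lt_n //.
rewrite -[i]/(nat_of_ord (Ordinal (le_n : (i < n.+1)%N))).
move: {i le_n} (Ordinal _) => i.
have [szy|szy] := eqVneq (size ys) (n.+1 - i)%N; last first.
  by apply: eq_altf (@altf0 _ _) => xs; rewrite PLval0 // (negPf szy) !andbF.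
have szy' : size ys == (n.+1 - i)%N by apply/eqP.
have [/(_ (Tuple szy'))] := althom_alternating (f i).
move=> /alternating_altf aF _; apply: eq_altf aF => xs; rewrite /PLval valK.
by rewrite [in RHS](insubT (fun s : seq V => size s == _) szy').
Qed.

(** The restriction of [f] to the diagonal. In degree 1 its value on [x], [y] is [[x, y] + x rhd y -
    y rhd x], the element acting in the curvature identity. *)
Definition bar n (f : PLcochain V n) xs := dsum xs (fval f).

Definition emb2 n (f : PLcochain V n) s : V :=
  dsum s (fun a b => fval f (map fst a) (map snd b)).

(* [emb f] is the alternating map on [V * V] which is [f_i] on [i] letters of the
   first factor and [n + 1 - i > 0] letters of the second, with values in the
   second factor; on words in the first factor alone it takes values in that
   factor, which are forced by the requirement that the diagonal be
   preserved. *)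
Definition emb n (f : PLcochain V n) s : (V * V)%type :=
  (bar f (map fst s), emb2 f s).

Definition in1 (x : V) : (V * V)%type := (x, 0).
Definition in2 (x : V) : (V * V)%type := (0, x).

Lemma linear_fst : linear (fun p : (V * V)%type => p.1). Proof. by []. Qed.
Lemma linear_snd : linear (fun p : (V * V)%type => p.2). Proof. by []. Qed.
Lemma linear_in1 : linear in1.
Proof.
move=> c u v; transitivity (c *: u + v, c *: (0 : V) + 0) => //.
by rewrite scaler0 addr0.
Qed.
Lemma linear_in2 : linear in2.
Proof.
move=> c u v; transitivity (c *: (0 : V) + 0, c *: u + v) => //.
by rewrite scaler0 addr0.
Qed.

Lemma altf_bar n (f : PLcochain V n) : altf (bar f).
Proof. by apply: altf_dsum => *; [exact: altf_fvall | exact: altf_fvalr]. Qed.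

Lemma altf_emb2 n (f : PLcochain V n) : altf (emb2 f).
Proof.
apply: altf_dsum => [b|a].
  exact: (altf_map linear_fst (altf_fvall f (map snd b))).
exact: (altf_map linear_snd (altf_fvalr f (map fst a))).
Qed.

Lemma altf_emb n (f : PLcochain V n) : altf (emb f).
Proof.
have a1 := altf_map linear_fst (altf_bar f).
split=> [a b c u v|a u v b]; rewrite /emb.
  by rewrite (altf_linear a1) (altf_linear (altf_emb2 f)).
by rewrite (altf_swap a1) (altf_swap (altf_emb2 f)).
Qed.

Lemma homog_emb n (f : PLcochain V n) : homog n (emb f).
Proof.
move=> s szs; congr (_, _); apply: dsum0 => a b sab; apply: fval0; apply: contra szs.
  by rewrite sab size_map => /andP[].
by rewrite !size_map sab => /andP[].
Qed.

Lemma map_fst_in1 xs : map fst (map in1 xs) = xs.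
Proof. by rewrite -map_comp map_id. Qed.

Lemma map_snd_in2 ys : map snd (map in2 ys) = ys.
Proof. by rewrite -map_comp map_id. Qed.

Lemma emb_in1 n (f : PLcochain V n) xs : emb f (map in1 xs) = in1 (bar f xs).
Proof.
rewrite /emb map_fst_in1; congr (_, _); rewrite /emb2 dsum_map.
apply: dsum0 => a b _; rewrite -!map_comp.
case: b => [|x b] /=; first exact: fval_nil.
exact: (altf_zero [::] _ (altf_fvalr _ _)).
Qed.

Lemma emb2_pure n (f : PLcochain V n) xs ys :
  emb2 f (map in1 xs ++ map in2 ys) = fval f xs ys.
Proof.
rewrite /emb2 dsum_cat dsum_map.
(* A letter placed in the wrong part is projected to zero, so only the splitting of the word into
   its two groups survives. *)
transitivity (dsum xs (fun a b => if size a == size xs then fval f (a ++ b) ys else 0)).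
  apply: eq_dsum => a b sab; rewrite dsum_map; case: b sab => [|x b] sab; last first.
    rewrite -sab -[X in X == _]addn0 eqn_add2l; apply: dsum0 => c d _.
    by rewrite map_cat /= (altf_zero [::] _ (altf_fvalr _ _)) scaler0.
  rewrite -sab addn0 eqxx cats0 -(dsum_nil_left ys (fval f a)); apply: eq_dsum => c d _.
  rewrite mul0n scale1r map_cat map_fst_in1; case: c => [|y c] /=; last first.
    by rewrite (altf_zero _ _ (altf_fvall _ _)).
  by rewrite cats0 map_snd_in2.
exact: (dsum_full xs (fval f ^~ ys)).
Qed.

Lemma emb_pure n (f : PLcochain V n) xs ys : ys != [::] ->
  emb f (map in1 xs ++ map in2 ys) = in2 (fval f xs ys).
Proof.
case: ys => // y ys _; rewrite /emb emb2_pure; congr (_, _).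
by rewrite map_cat /= (altf_zero _ _ (altf_bar f)).
Qed.

Lemma emb_in2 n (f : PLcochain V n) v xs ys :
  emb f (in2 v :: map in1 xs ++ map in2 ys) =
  (-1) ^+ size xs *: in2 (fval f xs (v :: ys)).
Proof.
rewrite (altf_move _ _ _ (altf_emb f)) size_map; congr (_ *: _).
exact: (emb_pure f xs (ys := v :: ys)).
Qed.

(** Each letter is the sum of its two components; the component in the second factor is moved behind
    [a], and the sign of this move is the weight in [dsum]. *)
Lemma altf_pure_expand (U : lmodType K) (F : seq (V * V)%type -> U) s : altf F ->
  F s = dsum s (fun a b => F (map in1 (map fst a) ++ map in2 (map snd b))).
Proof.
elim: s F => [//|x s IH] F aF /=.
have xE : x = 1 *: in1 x.1 + in2 x.2.
  by rewrite scale1r [x in LHS]surjective_pairing; congr (_, _); rewrite ?add0r ?addr0.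
rewrite [in LHS]xE (altf_linear aF [::]) scale1r /=.
rewrite (IH _ (altf_cons _ aF)) [in X in _ + X](IH _ (altf_cons _ aF)).
congr (_ + _); apply: eq_dsum => a b _.
by rewrite (altf_move _ _ _ aF) !size_map.
Qed.

End Embedding.

(** * The circle product as an unshuffle sum *)

Section CircleProduct.
Variables (K : fieldType) (V : lmodType K).
Implicit Types (xs ys : seq V).

Lemma fval_cons0 n (f : PLcochain V n) xs ys : fval f xs (0 :: ys) = 0.
Proof. exact: (altf_zero [::] _ (altf_fvalr _ _)). Qed.

Lemma fval_0cons n (f : PLcochain V n) xs ys : fval f (0 :: xs) ys = 0.
Proof. exact: (altf_zero [::] _ (altf_fvall _ _)). Qed.

Lemma fval_size n (f : PLcochain V n) xs ys :
  (size xs + size ys)%N != n.+1 -> fval f xs ys = 0.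
Proof. by move=> h; rewrite fval0 // (negPf h) andbF. Qed.

Lemma fval_gtn n (f : PLcochain V n) xs ys : (n < size xs)%N -> fval f xs ys = 0.
Proof. by move=> h; rewrite fval0 // leqNgt h. Qed.

Lemma bar_size n (f : PLcochain V n) xs : size xs != n.+1 -> bar f xs = 0.
Proof. by move=> h; apply: dsum0 => a b sab; rewrite fval_size ?sab. Qed.

(* First sum: [g] receives no letter of [ys], so that its value is [bar g a], in
   the first factor of [V * V].  Second sum: its value is in the second factor,
   and the extra sign moves it behind [b]. *)
Definition fcirc n m (f : PLcochain V n) (g : PLcochain V m) xs ys : V :=
  dsum xs (fun a b => fval f (bar g a :: b) ys) +
  dsum xs (fun a b => dsum ys (fun c d =>
    (-1) ^+ (size b * size c + size b) *: fval f b (fval g a c :: d))).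

Lemma sum_if_eq N p (U : lmodType K) (F : nat -> U) :
  \sum_(0 <= j < N) (if p == j then F j else 0) = if (p < N)%N then F p else 0.
Proof.
rewrite -big_mkcond /= (eq_bigl (fun j => j == p)) ?big_nat1_eq // => j.
Qed.

(** The [m.+1] letters [e] going to [g] are chosen first and then split; summing the inner
    splittings over [j] will produce [bar g e]. *)
Lemma PLcirc_leftE n m (f : PLcochain V n) (g : PLcochain V m) xs ys j :
  (j <= m < size xs)%N ->
  PLcirc_left f g (size xs) xs ys j =
  dsum xs (fun e c => if size e == m.+1 then
    dsum e (fun a b => if size a == j then fval f (fval g a b :: c) ys else 0) else 0).
Proof.
case/andP=> le_jm lt_m; rewrite /PLcirc_left /=.
have jm : (j + (m.+1 - j))%N = m.+1 by rewrite subnKC // leqW.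
rewrite -[in drop m.+1]jm.
rewrite (shuffle_sum3 (fun a b c => PLval f (size xs - m) (PLval g j a b :: c) ys)) //;
  last by rewrite jm subnKC.
rewrite jm; apply: eq_dsum => e c sec; case: eqP => // em.
apply: eq_dsum => a b _; case: eqP => // aj.
by rewrite /fval aj /= -sec em addSnnS addKn.
Qed.

(** The shuffle puts the letters [b] outside [g] first, so [dsumC] contributes [j * size b]. With
    [m = j + size c - 1], this plus [m * size b] has the parity of [size b * size c + size b]. *)
Lemma PLcirc_rightE n m (f : PLcochain V n) (g : PLcochain V m) xs ys j :
  (j <= m)%N -> (j <= size xs)%N -> (size xs <= n + m)%N ->
  size ys = ((n + m).+1 - size xs)%N ->
  PLcirc_right f g (size xs) xs ys j =
  dsum xs (fun a b => if size a == j then dsum ys (fun c d =>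
    (-1) ^+ (size b * size c + size b) *: fval f b (fval g a c :: d)) else 0).
Proof.
move=> le_jm le_jk le_k szy; rewrite /PLcirc_right.
(* When [n + j - size xs] would be negative there are no shuffles; the other side vanishes too, as
   [b] then has more than [n] letters. *)
have [le_kn|lt_nk] := leqP (size xs) (n + j); last first.
  rewrite big1 => [|s _]; last first.
    rewrite big_pred0 // => t; rewrite inE /= addn0.
    rewrite (_ : (n + j - _)%N = 0%N) ?addn0; last by apply/eqP; rewrite subn_eq0 ltnW.
    by rewrite gtn_eqF //; lia.
  apply/esym/dsum0 => a b sab; case: eqP => // aj; apply: dsum0 => c d _.
  rewrite fval_gtn ?scaler0 //.
  by rewrite -(ltn_add2l j) -[X in (_ < X + _)%N]aj sab addnC.
pose Phi b a := dsum ys (fun c d => (-1) ^+ (m * size b) *: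
  (if size c == (m.+1 - j)%N then fval f b (fval g a c :: d) else 0)).
transitivity (dsum xs (fun b a => if size b == (size xs - j)%N then Phi b a else 0)).
  rewrite -(shuffle_sum2 (N := size xs) Phi (erefl _) (subnK le_jk)).
  apply: eq_bigr => s _ /=.
  have sq : (m.+1 - j + (n + j - size xs))%N = size ys by lia.
  rewrite /Phi dsumZ -(shuffle_sum2 (fun c d => fval f _ (fval g _ c :: d)) (erefl _) sq).
  rewrite !scaler_sumr -szy; apply: eq_bigr => t _.
  have szp N (r : 'S_N) zs : size (@permute _ V N r zs) = N.
    by rewrite size_map size_enum_ord.
  have st : size (take (size xs - j) (permute s xs)) = (size xs - j)%N.
    by rewrite size_takel // szp leq_subr.
  have sd : size (drop (size xs - j) (permute s xs)) = j.
    by rewrite size_drop szp subKn.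
  by rewrite !PLval_fval st sd !eqxx !scalerA mulrAC.
rewrite dsumC; apply: eq_dsum => a b sab.
have -> : (size b == (size xs - j)%N) = (size a == j).
  by lia.
case: eqP => [aj|_]; last by rewrite scaler0.
rewrite /Phi -dsumZ; apply: eq_dsum => c d _; rewrite scalerA -exprD.
case: eqP => [cm|/eqP cm]; last first.
  rewrite (fval_size g) ?fval_cons0 ?scaler0 //; apply: contra cm => /eqP <-.
  by rewrite aj addKn.
congr (_ *: _); have -> : m = (j + size c).-1 by rewrite cm subnKC // leqW.
have c_gt0 : (0 < size c)%N by rewrite cm subn_gt0.
rewrite aj; case: (size c) c_gt0 => // k _; rewrite addnS /=.
apply: eq_signr; rewrite !(oddD, oddM, oddS) /=.
by case: (odd j); case: (odd k); case: (odd (size b)).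
Qed.

Lemma PLcirc_valE n m (f : PLcochain V n) (g : PLcochain V m) xs ys :
  (size xs <= n + m)%N -> size ys = ((n + m).+1 - size xs)%N ->
  PLcirc_val f g (size xs) xs ys = fcirc f g xs ys.
Proof.
move=> le_k szy; rewrite /PLcirc_val /fcirc.
(* Both ranges of [j] exhaust the splittings: [size a] is at most [size xs], and [g] has no
   component of index above [m]. *)
have R N : (size xs <= m -> N = (size xs).+1)%N -> (m < size xs -> N = m.+1)%N ->
    \sum_(0 <= j < N) PLcirc_right f g (size xs) xs ys j =
    dsum xs (fun a b => dsum ys (fun c d =>
      (-1) ^+ (size b * size c + size b) *: fval f b (fval g a c :: d))).
  move=> N1 N2; have [lek lem] : (N <= (size xs).+1 /\ N <= m.+1)%N.
    by case: (leqP (size xs) m) => h; [rewrite (N1 h)|rewrite (N2 h)]; lia.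
  rewrite (eq_big_nat _ _ (F2 := fun j => dsum xs (fun a b =>
    if size a == j then dsum ys (fun c d =>
      (-1) ^+ (size b * size c + size b) *: fval f b (fval g a c :: d))
    else 0))); last first.
    move=> j /= lt_j; apply: PLcirc_rightE => //.
      by rewrite -ltnS (leq_trans lt_j).
    by rewrite -ltnS (leq_trans lt_j).
  rewrite -dsum_sum; apply: eq_dsum => a b sab.
  rewrite (sum_if_eq _ _ (fun _ => dsum ys _)); case: ltnP => // le_Na.
  apply/esym/dsum0 => c d _; rewrite (fval_gtn g) ?fval_cons0 ?scaler0 //.
  case: (leqP (size xs) m) => h; last by rewrite -(N2 h).
  by move: le_Na; rewrite (N1 h) -sab ltnNge leq_addr.
case: leqP => lt_m.
  (* For [size xs <= m] the first sum of [fcirc] is zero, [bar g] requiring [m.+1] letters. *)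
  rewrite R // ?[in dsum xs _ + _]dsum0 ?add0r //; last by rewrite ltnNge lt_m.
  move=> a b sab; rewrite bar_size ?fval_0cons // ltn_eqF // ltnS.
  by rewrite (leq_trans _ lt_m) // -sab leq_addr.
rewrite R // 1?leqNgt ?lt_m //; congr (_ + _).
rewrite (eq_big_nat _ _ (F2 := fun j => dsum xs (fun e c => if size e == m.+1 then
    dsum e (fun a b => if size a == j then fval f (fval g a b :: c) ys else 0)
    else 0))); last first.
  by move=> j /= lt_j; apply: PLcirc_leftE; rewrite -ltnS lt_j.
rewrite -dsum_sum; apply: eq_dsum => e c _; case: eqP => [em|/eqP em]; last first.
  by rewrite big1 // bar_size // fval_0cons.
rewrite -dsum_sum (linear_dsum _ _ (altf_cons_linear c (altf_fvall f ys))).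
apply: eq_dsum => a b _.
rewrite (sum_if_eq _ _ (fun _ => fval f _ _)); case: ltnP => // lt_a.
by rewrite (fval_gtn g) ?fval_0cons.
Qed.

End CircleProduct.

(** * Compatibility of the embedding with the products *)

Section Morphism.
Variables (K : fieldType) (V : lmodType K).
Hypothesis nz2 : (2%:R : K) != 0.
Implicit Types (xs ys : seq V).

Lemma NRcirc_emb_pure n m (f : PLcochain V n) (g : PLcochain V m) xs ys : ys != [::] ->
  NRcirc (emb f) (emb g) (map (@in1 _ V) xs ++ map (@in2 _ V) ys) = in2 (fcirc f g xs ys).
Proof.
move=> nz_ys; rewrite /NRcirc dsum_cat dsum_map.
rewrite /fcirc -dsumD (linear_dsum _ _ (@linear_in2 _ V)); apply: eq_dsum => a b _.
(* The first sum of [fcirc] is spread over the splittings of [ys]: it is the case of empty [c],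
   where the inner value is in the first factor. For nonempty [c] that value is in the second
   factor. *)
rewrite dsum_map -(dsum_nil_left ys (fun d => fval f (bar g a :: b) d)) -dsumD.
rewrite (linear_dsum _ _ (@linear_in2 _ V)); apply: eq_dsum => c d scd.
rewrite !size_map; case: c scd => [|y c] scd.
  rewrite cats0 emb_in1 muln0 scale1r fval_nil fval_cons0 scaler0 addr0.
  rewrite -[in1 _ :: _]/(map (@in1 _ V) (_ :: _) ++ _) emb_pure //.
  by case: d scd nz_ys => //; case: (ys).
rewrite emb_pure // emb_in2 add0r scalerA -exprD.
by rewrite (linear_scale _ _ (@linear_in2 _ V)).
Qed.

Lemma NRcirc_emb_in1 n m (f : PLcochain V n) (g : PLcochain V m) xs :
  NRcirc (emb f) (emb g) (map (@in1 _ V) xs) =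
  in1 (dsum xs (fun a b => bar f (bar g a :: b))).
Proof.
rewrite /NRcirc dsum_map (linear_dsum _ _ (@linear_in1 _ V)); apply: eq_dsum => a b _.
by rewrite emb_in1 -map_cons emb_in1.
Qed.

Lemma altf_cat_left (W U : lmodType K) (F : seq W -> U) c :
  altf F -> altf (fun s => F (c ++ s)).
Proof. by elim: c F => //= x c IH F /(altf_cons x)/IH. Qed.

Lemma altf_cat_right (W U : lmodType K) (F : seq W -> U) c :
  altf F -> altf (fun s => F (s ++ c)).
Proof.
move=> aF; split=> [a b d u v|a u v b]; rewrite -!catA /=; first exact: (altf_linear aF).
exact: (altf_swap aF).
Qed.

Definition NRcirc2 n m (f : PLcochain V n) (g : PLcochain V m) s : V :=
  (NRcirc (emb f) (emb g) s).2.

Lemma altf_NRcirc2 n m (f : PLcochain V n) (g : PLcochain V m) : altf (NRcirc2 f g).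
Proof.
exact: altf_linear_comp (@linear_snd _ V) (altf_NRcirc (altf_emb f) (altf_emb g)).
Qed.

(** The formula is the second component of the Nijenhuis-Richardson product on words with letters in
    the two factors, and inherits alternation in each group from it. *)
Lemma PLcirc_alternating : PLcirc_well_defined V.
Proof.
move=> n m f g k x y; rewrite /PLcirc ffunE.
have pE (x' : k.-tuple V) (y' : ((n + m).+1 - k)%N.-tuple V) :
    PLcirc_val f g k x' y' = NRcirc2 f g (map (@in1 _ V) x' ++ map (@in2 _ V) y').
  have le_k : (k <= n + m)%N by rewrite -ltnS.
  rewrite /NRcirc2 NRcirc_emb_pure; last by rewrite -size_eq0 size_tuple subn_eq0 -ltnNge ltnS.
  have := @PLcirc_valE _ _ _ _ f g x' y'; rewrite !size_tuple; exact.
(* Alternation is what prevents [insubd] from returning its default value 0. *)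
rewrite insubdK //; apply/asboolP; split=> z.
  have -> : (fun x0 : k.-tuple V => PLcirc_val f g k x0 z) =
      fun x0 => NRcirc2 f g (map (@in1 _ V) x0 ++ map (@in2 _ V) z).
    by apply: funext => x0; exact: pE.
  have aF := altf_map (@linear_in1 _ V)
    (altf_cat_right (map (@in2 _ V) z) (altf_NRcirc2 f g)).
  exact: (@altf_alternating _ _ _ k _ nz2 aF).
have -> : (fun y0 : ((n + m).+1 - k)%N.-tuple V => PLcirc_val f g k z y0) =
    fun y0 => NRcirc2 f g (map (@in1 _ V) z ++ map (@in2 _ V) y0).
  by apply: funext => y0; exact: pE.
have aF := altf_map (@linear_in2 _ V) (altf_cat_left (map (@in1 _ V) z) (altf_NRcirc2 f g)).
exact: (@altf_alternating _ _ _ _ _ nz2 aF).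
Qed.

Lemma fval_tuple n (f : PLcochain V n) xs ys (le_n : (size xs < n.+1)%N)
    (szy : size ys == (n.+1 - Ordinal le_n)%N) :
  fval f xs ys = f (Ordinal le_n) (in_tuple xs) (Tuple szy).
Proof. by rewrite -PLval_tuple. Qed.

Lemma fval_circ n m (f : PLcochain V n) (g : PLcochain V m) xs ys :
  fval (PLcirc f g) xs ys = NRcirc2 f g (map (@in1 _ V) xs ++ map (@in2 _ V) ys).
Proof.
rewrite /NRcirc2.
have [sz|sz] := eqVneq (size xs + size ys)%N (n + m).+1; last first.
  rewrite fval_size // (homog_NRcirc (altf_emb f) (homog_emb f) (homog_emb g)) //.
  by rewrite size_cat !size_map.
(* If the first group takes all the letters, the product lies in the first factor and its second
   component is 0. *)
have [le_k|lt_k] := leqP (size xs) (n + m); last first.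
  rewrite fval_gtn //; have -> : ys = [::].
    by apply: size0nil; apply/eqP; rewrite -leqn0 -(leq_add2l (size xs)) addn0 sz.
  by rewrite cats0 NRcirc_emb_in1.
have szy : size ys == ((n + m).+1 - size xs)%N by rewrite -sz addKn.
rewrite (@fval_tuple _ _ _ _ (le_k : (size xs < (n + m).+1)%N) szy).
rewrite PLcirc_alternating /= PLcirc_valE //; last exact/eqP.
rewrite NRcirc_emb_pure // -size_eq0 (eqP szy) subn_eq0 -ltnNge //.
Qed.

Definition diag (x : V) : (V * V)%type := (x, x).

Lemma emb_diag n (f : PLcochain V n) xs : emb f (map diag xs) = diag (bar f xs).
Proof.
have mE (h : (V * V)%type -> V) s : h \o diag =1 idfun -> map h (map diag s) = s.
  by move=> E; rewrite -map_comp (eq_map E) map_id.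
rewrite /emb mE //; congr (_, _); rewrite /emb2 dsum_map.
by apply: eq_dsum => a b _; rewrite !mE.
Qed.

(** Alternating maps agree once they agree on words of letters of the first factor followed by
    letters of the second; [NRcirc_emb_pure] settles the case of a nonempty second group. *)
Lemma emb_circ n m (f : PLcochain V n) (g : PLcochain V m) :
  emb (PLcirc f g) =1 NRcirc (emb f) (emb g).
Proof.
move=> s; rewrite (altf_pure_expand s (altf_emb (PLcirc f g))).
rewrite (altf_pure_expand s (altf_NRcirc (altf_emb f) (altf_emb g))).
apply: eq_dsum => a b _; move: (map fst a) (map snd b) => xs ys.
have [->|nz_ys] := eqVneq ys [::]; last first.
  by rewrite emb_pure // NRcirc_emb_pure // fval_circ /NRcirc2 NRcirc_emb_pure.
rewrite !cats0 emb_in1 NRcirc_emb_in1; congr in1.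
(* Values in the first factor are compared on the diagonal: expanding the diagonal letters gives
   [bar (PLcirc f g)], while stability of the diagonal gives the sum of the
   [bar f (bar g a :: b)]. *)
transitivity (NRcirc2 f g (map diag xs)).
  rewrite (altf_pure_expand _ (altf_NRcirc2 f g)) dsum_map; apply: eq_dsum => a' b' _.
  by rewrite fval_circ -!map_comp.
rewrite /NRcirc2 /NRcirc dsum_map (linear_dsum _ _ (@linear_snd _ V)); apply: eq_dsum => a' b' _.
by rewrite emb_diag -map_cons emb_diag.
Qed.

Lemma eq_fval n (f g : PLcochain V n) :
  (forall xs ys, fval f xs ys = fval g xs ys) -> f = g.
Proof.
move=> E; apply/ffunP => i; apply/val_inj/funext => x; apply/funext => y /=.
rewrite -!PLval_tuple -[X in PLval _ X](size_tuple x).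
by rewrite -[X in _ = PLval _ X _ _](size_tuple x); exact: E.
Qed.

Lemma emb_inj n (f g : PLcochain V n) : emb f =1 emb g -> f = g.
Proof.
move=> E; apply: eq_fval => xs ys; rewrite -!emb2_pure.
exact: (congr1 snd (E (map (@in1 _ V) xs ++ map (@in2 _ V) ys))).
Qed.

Lemma fval_linear n (c : K) (f g : PLcochain V n) xs ys :
  fval (c *: f + g) xs ys = c *: fval f xs ys + fval g xs ys.
Proof.
rewrite /fval /PLval; case: insub => [o|]; last by rewrite scaler0 addr0.
case: insub => [x|]; last by rewrite scaler0 addr0.
case: insub => [y|]; last by rewrite scaler0 addr0.
by rewrite !ffunE.
Qed.

Lemma emb_linear n (c : K) (f g : PLcochain V n) s :
  emb (c *: f + g) s = c *: emb f s + emb g s.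
Proof.
rewrite /emb; congr (_, _); rewrite /bar /emb2 /= -dsumZ -dsumD;
  by apply: eq_dsum => a b _; rewrite fval_linear.
Qed.

(** The type of [emb f] does not depend on the degree, so casts disappear under [emb]; this lets the
    graded identities be checked on words. *)
Lemma emb_degcast n p (e : n = p) (f : PLspace V n) :
  emb (degcast e f : PLcochain V p) =1 emb (f : PLcochain V n).
Proof. by case: p / e. Qed.

End Morphism.

(** * Graded Lie brackets *)

Section GradedLieBracket.
Variables (K : fieldType) (W : lmodType K).
Implicit Types F G H : seq W -> W.

Definition NRbracket (n m : nat) F G s : W :=
  NRcirc F G s - (-1) ^+ (n * m)%N *: NRcirc G F s.

Lemma eq_NRbracket n m F F' G G' : F =1 F' -> G =1 G' ->
  NRbracket n m F G =1 NRbracket n m F' G'.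
Proof. by move=> eF eG s; rewrite /NRbracket (eq_NRcirc eF eG) (eq_NRcirc eG eF). Qed.

(** The differences [xi - yi] stand for signed associators with first argument [F], [G], [H], and
    the primed ones for those with the last two arguments exchanged. Their three symmetries combine
    into the twelve terms of the Jacobi identity. *)
Lemma Jacobi_of_associators (A : zmodType)
    (x1 y1 x1' y1' x2 y2 x2' y2' x3 y3 x3' y3' : A) :
  x1 - y1 = x1' - y1' -> x2 - y2 = x2' - y2' -> x3 - y3 = x3' - y3' ->
  y1 - y1' - (x2' - x3') = x1 - x2 - (y3 - y3') + (y2 - y2' - (x1' - x3)).
Proof.
move=> e1 e2 e3.
have -> : x1 = x1' - y1' + y1 by rewrite -e1 subrK.
have -> : x2 = x2' - y2' + y2 by rewrite -e2 subrK.
have -> : x3 = x3' - y3' + y3 by rewrite -e3 subrK.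
rewrite !opprD !opprK !addrA.
rewrite [RHS](ACl (3*2*4*12*(1*11)*(5*10)*(9*6)*(14*7)*(8*13)))%AC /=.
by rewrite !subrr !addr0.
Qed.

Lemma NRbracket_Jacobi n m p F G H s :
  altf F -> altf G -> altf H -> homog n F -> homog m G -> homog p H ->
  NRbracket n (m + p) F (NRbracket m p G H) s =
  NRbracket (n + m) p (NRbracket n m F G) H s +
  (-1) ^+ (n * m)%N *: NRbracket m (n + p) G (NRbracket n p F H) s.
Proof.
move=> aF aG aH hF hG hH.
have br_r a b F' G' H' : altf F' -> NRcirc F' (NRbracket a b G' H') s =
    NRcirc F' (NRcirc G' H') s - (-1) ^+ (a * b)%N *: NRcirc F' (NRcirc H' G') s.
  move=> aF'; rewrite (eq_NRcirc (F' := F')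
    (G' := fun s => (- (-1) ^+ (a * b)%N) *: NRcirc H' G' s + NRcirc G' H' s)) //; last first.
    by move=> t /=; rewrite scaleNr addrC.
  by rewrite (NRcirc_linearr _ (NRcirc H' G') (NRcirc G' H') aF') scaleNr addrC.
have br_l a b F' G' H' : NRcirc (NRbracket a b G' H') F' s =
    NRcirc (NRcirc G' H') F' s - (-1) ^+ (a * b)%N *: NRcirc (NRcirc H' G') F' s.
  rewrite (eq_NRcirc (G' := F')
    (F' := fun s => NRcirc G' H' s + (- (-1) ^+ (a * b)%N) *: NRcirc H' G' s)) //; last first.
    by move=> t /=; rewrite scaleNr.
  by rewrite NRcircDl NRcircZl scaleNr.
rewrite /NRbracket -/(NRbracket m p G H) -/(NRbracket n m F G) -/(NRbracket n p F H).
rewrite !br_r // !br_l.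
have e1 := NRassoc_sym s aF hG hH; have e2 := NRassoc_sym s aG hF hH.
have e3 := NRassoc_sym s aH hF hG.
have sqr k : (-1) ^+ k * (-1) ^+ k = 1 :> K by rewrite -expr2 sqrr_sign.
rewrite /NRassoc in e1 e2 e3.
(* By additivity of exponents, every sign of the Jacobi identity is a product of these three. *)
set al := (-1) ^+ (m * p) in e1 *; set be := (-1) ^+ (n * p) in e2 *.
set ga := (-1) ^+ (n * m) in e3 *.
have -> : (-1) ^+ (n * (m + p)) = ga * be by rewrite mulnDr exprD.
have -> : (-1) ^+ ((n + m) * p) = al * be by rewrite mulnDl exprD mulrC.
have -> : (-1) ^+ (m * (n + p)) = ga * al by rewrite mulnDr exprD [(m * n)%N]mulnC.
have gga : ga * (ga * al) = al by rewrite mulrA sqr mul1r.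
have gba : ga * be * al = al * be * ga by rewrite mulrC [ga * be]mulrC mulrA.
rewrite !scalerBr !scalerA gga gba; apply: Jacobi_of_associators.
- by rewrite e1 scalerBr.
- by rewrite -!scalerA -!scalerBr e2 !scalerBr !scalerA.
- by rewrite -!scalerA -!scalerBr e3 !scalerBr !scalerA.
Qed.

End GradedLieBracket.

(** * Transfer of the graded Lie structure along the embedding *)

Section PLbracket.
Variables (K : fieldType) (V : lmodType K).
Hypothesis nz2 : (2%:R : K) != 0.

Lemma embZ n c (f : PLcochain V n) s : emb (c *: f) s = c *: emb f s.
Proof.
rewrite -(linear_scale c f (h := fun g : PLcochain V n => emb g s)) // => d g h.
exact: emb_linear.
Qed.

Lemma emb_bracket n m (f : PLspace V n) (g : PLspace V m) :
  emb (PLbracket V n m f g : PLcochain V _) =1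
  NRbracket n m (emb (f : PLcochain V n)) (emb (g : PLcochain V m)).
Proof.
move=> s; rewrite /PLbracket addrC -scaleNr emb_linear emb_degcast !emb_circ //.
by rewrite scaleNr addrC.
Qed.

Lemma PLcirc_linearl n m (g : PLcochain V m) :
  linear (fun f : PLcochain V n => PLcirc f g).
Proof.
move=> c f f'; apply: emb_inj => s; rewrite emb_linear !emb_circ //.
have -> : emb (c *: f + f') = fun s => c *: emb f s + emb f' s.
  by apply: funext => t; rewrite emb_linear.
by rewrite NRcircDl NRcircZl.
Qed.

Lemma PLcirc_linearr n m (f : PLcochain V n) :
  linear (fun g : PLcochain V m => PLcirc f g).
Proof.
move=> c g g'; apply: emb_inj => s; rewrite emb_linear !emb_circ //.
have -> : emb (c *: g + g') = fun s => c *: emb g s + emb g' s.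
  by apply: funext => t; rewrite emb_linear.
by rewrite NRcirc_linearr //; exact: altf_emb.
Qed.

Lemma degcast_linear n p (e : n = p) : linear (fun f : PLspace V n => degcast e f).
Proof. by case: p / e. Qed.

Lemma PLbracket_linearl n m (g : PLspace V m) :
  linear (fun f : PLspace V n => PLbracket V n m f g).
Proof.
move=> c f f'; rewrite /PLbracket PLcirc_linearl (PLcirc_linearr g) degcast_linear.
by rewrite scalerDr opprD addrACA scalerA mulrC -scalerA -scalerBr.
Qed.

Lemma PLbracket_antisym n m (f : PLspace V n) (g : PLspace V m) :
  PLbracket V n m f g =
  - ((-1) ^+ (n * m)%N *: degcast (addnC m n) (PLbracket V m n g f)).
Proof.
apply: emb_inj => s.
rewrite -scaleNr embZ emb_degcast !emb_bracket /NRbracket.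
rewrite [(m * n)%N]mulnC scaleNr -scalerN opprB scalerBr scalerA.
by rewrite -expr2 sqrr_sign scale1r.
Qed.

Lemma PLbracket_linearr n m (f : PLspace V n) : linear (PLbracket V n m f).
Proof.
move=> c g g'; rewrite ![PLbracket V n m f _]PLbracket_antisym PLbracket_linearl.
by rewrite degcast_linear scalerDr opprD scalerA mulrC -scalerA scalerN.
Qed.

Lemma PLbracket_graded_Lie : graded_Lie_algebra (PLbracket V).
Proof.
split.
- exact: PLbracket_linearl.
- exact: PLbracket_linearr.
- exact: PLbracket_antisym.
move=> n m p f g h; apply: emb_inj => s.
rewrite emb_bracket addrC emb_linear !emb_degcast !emb_bracket.
rewrite !(eq_NRbracket _ _ (frefl _) (emb_bracket _ _)).
rewrite (eq_NRbracket _ _ (emb_bracket _ _) (frefl _)).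
by rewrite NRbracket_Jacobi 1?addrC //; (exact: altf_emb || exact: homog_emb).
Qed.

End PLbracket.

(** * Maurer-Cartan elements *)

Section MaurerCartan.
Variables (K : fieldType) (V : lmodType K).
Hypothesis nz2 : (2%:R : K) != 0.
Implicit Types pi : PLspace V 1.

Lemma fval_degree1 pi xs ys : fval (pi : PLcochain V 1) xs ys =
  match xs, ys with
  | [::], [:: y; z] => PLbr pi y z
  | [:: x], [:: y] => PLrhd pi x y
  | _, _ => 0
  end.
Proof.
case: xs => [|x [|x' xs]]; case: ys => [|y [|z [|u ys]]] //=;
  by rewrite fval0 //= ?andbF // -?addnE ?addnS.
Qed.

(** In degree 1 the two terms of the bracket have equal sign, so it is twice the circle product, and
    2 is invertible. *)
Lemma Maurer_Cartan_circ pi :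
  Maurer_Cartan (PLbracket V) pi <-> PLcirc pi pi = 0 :> PLcochain V 2.
Proof.
rewrite /Maurer_Cartan /PLbracket [degcast _ _](_ : _ = PLcirc pi pi); last first.
  (* The cast is along a proof of [1 + 1 = 1 + 1], equal to [erefl] by uniqueness of identity proofs
     on [nat]. *)
  by rewrite [addnC 1 1](_ : _ = erefl) //; exact: eq_irrelevance.
rewrite expr1 scaleN1r opprK -[_ + _]/(PLcirc pi pi *+ 2) -scaler_nat; split=> [/eqP|->].
  by rewrite scaler_eq0 (negPf nz2) => /eqP.
by rewrite scaler0.
Qed.

Lemma fval_zero n xs ys : fval (0 : PLcochain V n) xs ys = 0.
Proof.
rewrite -emb2_pure -[0](scale0r (0 : PLcochain V n)) -[emb2 _ _]/(emb _ _).2.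
by rewrite embZ scale0r.
Qed.

Lemma circ_eq0 pi :
  PLcirc pi pi = 0 :> PLcochain V 2 <->
  [/\ forall x y z, fcirc (pi : PLcochain V 1) pi [::] [:: x; y; z] = 0,
      forall x y z, fcirc (pi : PLcochain V 1) pi [:: x] [:: y; z] = 0 &
      forall x y z, fcirc (pi : PLcochain V 1) pi [:: x; y] [:: z] = 0].
Proof.
have E xs ys : ys != [::] ->
    fval (PLcirc (pi : PLcochain V 1) pi) xs ys = fcirc (pi : PLcochain V 1) pi xs ys.
  by move=> nz; rewrite fval_circ // /NRcirc2 NRcirc_emb_pure.
split=> [c0|[c1 c2 c3]].
  by split=> x y z; rewrite -E // c0 fval_zero.
apply: eq_fval => xs ys; rewrite fval_zero.
have [/andP[le_n /eqP sz]|] :=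
  boolP ((size xs <= 1 + 1) && (size xs + size ys == (1 + 1).+1))%N; last exact: fval0.
case: xs le_n sz => [|x [|x' [|x'' xs]]] // _; case: ys => [|y [|z [|u [|t ys]]]] //= _;
  by rewrite E.
Qed.

Lemma fcirc_Jacobi pi x y z :
  fcirc (pi : PLcochain V 1) pi [::] [:: x; y; z] =
  PLbr pi (PLbr pi x y) z - PLbr pi (PLbr pi x z) y + PLbr pi (PLbr pi y z) x.
Proof.
rewrite /fcirc /bar /= !fval_degree1 /=.
by rewrite !(scaler0, add0r, addr0, mul0n, addn0, expr0, expr1, sqrrN, expr1n,
  scale1r, scaleN1r, oppr0).
Qed.

Lemma fcirc_derivation pi x y z :
  fcirc (pi : PLcochain V 1) pi [:: x] [:: y; z] =
  PLbr pi (PLrhd pi x y) z - PLbr pi (PLrhd pi x z) y - PLrhd pi x (PLbr pi y z).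
Proof.
rewrite /fcirc /bar /= !fval_degree1 /=.
rewrite !(scaler0, add0r, addr0, mul0n, addn0, expr0, expr1, sqrrN, expr1n,
  scale1r, scaleN1r, oppr0).
by rewrite -[(-1) ^+ (1 * 2 + 1)]signr_odd expr1 scaleN1r.
Qed.

Lemma fcirc_curvature pi x y z :
  fcirc (pi : PLcochain V 1) pi [:: x; y] [:: z] =
  PLrhd pi (PLbr pi x y + PLrhd pi x y - PLrhd pi y x) z
  + PLrhd pi y (PLrhd pi x z) - PLrhd pi x (PLrhd pi y z).
Proof.
rewrite /fcirc /bar /= !fval_degree1 /=.
rewrite !(scaler0, add0r, addr0, mul0n, addn0, expr0, expr1, sqrrN, expr1n,
  scale1r, scaleN1r, oppr0).
(* This term comes from feeding [x], [y] and no letter of the second group to the inner [pi], whose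
   value is then 0. *)
rewrite -[PLbr pi 0 z]/(fval (pi : PLcochain V 1) [::] [:: 0; z]) fval_cons0 add0r addrA.
by rewrite [_ + (_ + PLbr _ _ _)]addrA [_ + PLbr pi x y]addrC addrA.
Qed.

Lemma PLbr_bilinear pi : bilinear_op (PLbr pi).
Proof.
split=> x; first exact: (altf_linear (altf_fvalr (pi : PLcochain V 1) [::]) [::] [:: x]).
exact: (altf_linear (altf_fvalr (pi : PLcochain V 1) [::]) [:: x] [::]).
Qed.

Lemma PLrhd_bilinear pi : bilinear_op (PLrhd pi).
Proof.
split=> x; first exact: (altf_linear (altf_fvall (pi : PLcochain V 1) [:: x]) [::] [::]).
exact: (altf_linear (altf_fvalr (pi : PLcochain V 1) [:: x]) [::] [::]).
Qed.

Lemma PLbr_swap pi x y : PLbr pi x y = - PLbr pi y x.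
Proof. exact: (altf_swap (altf_fvalr (pi : PLcochain V 1) [::]) [::] x y [::]). Qed.

Lemma PLbr_alternating pi x : PLbr pi x x = 0.
Proof. exact: (altf_repeat [::] x [::] [::] nz2 (altf_fvalr _ [::])). Qed.

(** Antisymmetry turns the cyclic form of the Jacobiator into its shuffle form, with the opposite
    sign. *)
Lemma PLbr_Jacobiator pi x y z :
  PLbr pi x (PLbr pi y z) + PLbr pi y (PLbr pi z x) + PLbr pi z (PLbr pi x y) =
  - fcirc (pi : PLcochain V 1) pi [::] [:: x; y; z].
Proof.
have brN u v : PLbr pi u (- v) = - PLbr pi u v.
  by rewrite -scaleN1r (linear_scale _ _ (bilinear_opr (PLbr_bilinear pi) u)) scaleN1r.
rewrite fcirc_Jacobi !(PLbr_swap pi (PLbr pi _ _)) (PLbr_swap pi z x) brN.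
by rewrite !opprD !opprK addrC addrA addrAC.
Qed.

Lemma Maurer_Cartan_post_Lie pi :
  Maurer_Cartan (PLbracket V) pi <-> post_Lie_structure (PLbr pi) (PLrhd pi).
Proof.
rewrite Maurer_Cartan_circ circ_eq0; split=> [[c1 c2 c3]|[[_ _ J] _ D C]].
  split.
  - split; [exact: PLbr_bilinear|exact: PLbr_alternating|].
    by move=> x y z; rewrite PLbr_Jacobiator c1 oppr0.
  - exact: PLrhd_bilinear.
  - move=> x y z; have /eqP := c2 x y z; rewrite fcirc_derivation subr_eq0 => /eqP <-.
    by rewrite [PLbr pi y _]PLbr_swap.
  - move=> x y z; have /eqP := c3 x y z.
    by rewrite fcirc_curvature -addrA addr_eq0 opprB => /eqP.
split=> x y z.
- by apply: oppr_inj; rewrite -PLbr_Jacobiator J oppr0.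
- by rewrite fcirc_derivation D [PLbr pi y _]PLbr_swap subrr.
- by rewrite fcirc_curvature C subrK subrr.
Qed.

Lemma eq_PLstructure pi pi' : PLbr pi = PLbr pi' -> PLrhd pi = PLrhd pi' -> pi = pi'.
Proof. by move=> Eb Er; apply: eq_fval => xs ys; rewrite !fval_degree1 Eb Er. Qed.

(** * The degree 1 cochain of a given pair of products *)

Section Structure.
Variables br rhd : V -> V -> V.
Hypotheses (br_bilinear : bilinear_op br) (br_alternating : forall x, br x x = 0).
Hypothesis rhd_bilinear : bilinear_op rhd.

Definition structure_val (xs ys : seq V) : V :=
  match xs, ys with
  | [::], [:: y; z] => br y z
  | [:: x], [:: y] => rhd x y
  | _, _ => 0
  end.

Definition PLstructure : PLspace V 1 :=
  [ffun i : 'I_2 => insubd (0 : althom V i (2 - i))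
     (fun (x : i.-tuple V) (y : (2 - i)%N.-tuple V) => structure_val x y)] : PLcochain V 1.

Lemma br_swap x y : br x y = - br y x.
Proof.
have brDl u v w : br (u + v) w = br u w + br v w.
  by rewrite -[u]scale1r (bilinear_opl br_bilinear) !scale1r.
have brDr u v w : br w (u + v) = br w u + br w v.
  by rewrite -[u]scale1r (bilinear_opr br_bilinear) !scale1r.
have /eqP := br_alternating (x + y).
by rewrite brDl !brDr !br_alternating add0r addr0 addr_eq0 => /eqP.
Qed.

Lemma altf_structure_val_r xs : altf (structure_val xs).
Proof.
case: xs => [|x [|x' xs]]; last first.
- exact: altf0.
- split=> [[|? [|? ?]] [|? ?] c u v|[|? [|? ?]] u v b] /=;
    rewrite ?scaler0 ?addr0 ?oppr0 //.
  exact: (bilinear_opr rhd_bilinear).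
- split=> [[|? [|? [|? ?]]] [|? [|? ?]] c u v|[|? [|? [|? ?]]] u v [|? ?]] /=;
    rewrite ?scaler0 ?addr0 ?oppr0 //.
  + exact: (bilinear_opl br_bilinear).
  + exact: (bilinear_opr br_bilinear).
  + exact: br_swap.
Qed.

Lemma altf_structure_val_l ys : altf (structure_val^~ ys).
Proof.
case: ys => [|y [|y' ys]];
  split=> [[|? [|? ?]] [|? ?] c u v|[|? [|? ?]] u v b] /=;
  rewrite ?scaler0 ?addr0 ?oppr0 //.
exact: (bilinear_opl rhd_bilinear).
Qed.

Lemma PLstructureE (i : 'I_2) (x : i.-tuple V) (y : (2 - i)%N.-tuple V) :
  (PLstructure : PLcochain V 1) i x y = structure_val x y.
Proof.
rewrite /PLstructure ffunE insubdK //; apply/asboolP; split=> z.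
  exact: (@altf_alternating _ _ _ _ _ nz2 (altf_structure_val_l z)).
exact: (@altf_alternating _ _ _ _ _ nz2 (altf_structure_val_r z)).
Qed.

Lemma PLbr_structure : PLbr PLstructure = br.
Proof.
apply: funext => y; apply: funext => z.
exact: etrans (PLval_tuple (PLstructure : PLcochain V 1) (i := ord0) [tuple] [tuple y; z])
  (PLstructureE _ _).
Qed.

Lemma PLrhd_structure : PLrhd PLstructure = rhd.
Proof.
apply: funext => x; apply: funext => y.
exact: etrans (PLval_tuple (PLstructure : PLcochain V 1) (i := ord_max) [tuple x] [tuple y])
  (PLstructureE _ _).
Qed.

End Structure.



End MaurerCartan.

Theorem theorem2p17 (K : fieldType) (charK : [pchar K]%R =i pred0)
    (V : lmodType K) :
  [/\ PLcirc_well_defined V,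
      graded_Lie_algebra (PLbracket V),
      (forall pi : PLspace V 1,
         Maurer_Cartan (PLbracket V) pi <->
         post_Lie_structure (PLbr pi) (PLrhd pi))
    & (forall br rhd : V -> V -> V, post_Lie_structure br rhd ->
         exists! pi : PLspace V 1, PLbr pi = br /\ PLrhd pi = rhd)].
Proof.
(* Characteristic zero enters through the invertibility of 2. *)
have nz2 : (2%:R : K) != 0 by rewrite ((pcharf0P K).1 charK).
split; first exact: PLcirc_alternating.
- exact: PLbracket_graded_Lie.
- exact: Maurer_Cartan_post_Lie.
move=> br rhd [[br_bi br_alt _] rhd_bi _ _]; exists (PLstructure br rhd); split.
  by split; [exact: PLbr_structure | exact: PLrhd_structure].
move=> pi [Eb Er]; apply: eq_PLstructure; rewrite ?PLbr_structure ?PLrhd_structure //.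
Qed.
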